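(* Let $(\Omega,\mu,d)$ be a metric measure space with $\mu(\Omega)<\infty$. For $1\le p\le q\le\infty$, let $X=L^q(\Omega)$ or $X=\mathcal C_b(\Omega)$. Let $J\ge0$ be a kernel and $K_Ju(x)=\int_\Omega J(x,y)u(y)\,dy$. Let $h\in L^\infty(\Omega)$ if $X=L^q(\Omega)$, and $h\in\mathcal C_b(\Omega)$ if $X=\mathcal C_b(\Omega)$. If $K_J\in\mathcal L(L^p(\Omega),X)$ is compact, $h$ satisfies $$h(x)\ge\alpha>0\quad\text{for all }x\in\Omega,$$ and $u_0\in L^p(\Omega)$, then the group $S_{K,h}(t)=e^{(K_J-hI)t}$ associated to the problem $$u_t(x,t)=(K_J-hI)u(x,t),\quad x\in\Omega,\ t>0,\qquad u(x,0)=u_0(x),\quad x\in\Omega,$$ satisfies $$u(t)=S_{K,h}(t)u_0=S_1(t)u_0+S_2(t)u_0$$ with (i) $S_1(t)\in\mathcal L(L^p(\Omega))$ for all $t>0$, and $\|S_1(t)\|_{\mathcal L(L^p(\Omega),L^p(\Omega))}\to0$ exponentially as $t\to\infty$; (ii) $S_2(t)\in\mathcal L(L^p(\Omega),X)$ is compact for all $t>0$. Therefore $S_{K,h}(t)$ is asymptotically smooth.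
   Context: A metric measure space $(\Omega,\mu,d)$ is a metric space $(\Omega,d)$ with a $\sigma$-finite, regular, complete Borel measure $\mu$ that associates a finite positive measure to the balls of $\Omega$. Integration $dy$ is with respect to $\mu$. $\mathcal C_b(\Omega)$ is the space of bounded continuous functions with the sup norm. The group $S_{K,h}(t)$ acts on $L^p(\Omega)$. A semigroup $T(t)$, $t\ge0$, on a Banach space $Y$ is asymptotically smooth (in the sense of Hale) if for every nonempty closed bounded set $B\subset Y$ with $T(t)B\subset B$ for all $t\ge0$ there is a compact set $C\subset B$ that attracts $B$, i.e. $\sup_{b\in B}\operatorname{dist}(T(t)b,C)\to0$ as $t\to\infty$. *)

(* Defs.v *)
From HB Require Import structures.
From mathcomp Require Import all_boot all_order all_algebra.
From mathcomp Require Import all_classical all_reals all_analysis.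
From mathcomp Require Import ess_sup_inf measurable_realfun.

Set Implicit Arguments.
Unset Strict Implicit.
Unset Printing Implicit Defensive.

Import Order.TTheory GRing.Theory Num.Theory.
Import numFieldNormedType.Exports.

Local Open Scope classical_set_scope.
Local Open Scope ring_scope.

(* The library's L^p type [LspaceType mu p1], whose elements are classes of
   a.e. equal measurable functions, as a normed module for the L^p norm. *)
Section LspaceStructure.
Context d (T : measurableType d) (R : realType).
Variables (mu : {measure set T -> \bar R}) (p : \bar R) (p1 : (1 <= p)%E).
Local Notation L := (LspaceType mu p1).

Lemma ae_eq_Lnorm (f g : T -> R) : measurable_fun setT f ->
  measurable_fun setT g -> f = g %[ae mu] ->
  ('N[mu]_p[EFin \o f] = 'N[mu]_p[EFin \o g])%E.
Proof.
move=> mf mg fg; rewrite unlock /Lnorm; case: p p1 => [r r1|_|//].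
- have mr (k : T -> R) : measurable_fun setT k ->
      measurable_fun setT (fun x => (`|(EFin \o k) x| `^ r)%E).
    move=> mk; apply: (measurableT_comp (measurable_poweR _)).
    by apply: measurableT_comp => //; exact/measurable_EFinP.
  congr (_ `^ _)%E; apply: ae_eq_integral => //; [exact: mr|exact: mr|].
  by apply: filterS fg => x /(_ I) fgx _ /=; rewrite fgx.
- case: ifPn => // _; apply: eq_ess_sup.
  by apply: filterS fg => x /(_ I) fgx /=; rewrite fgx.
Qed.

Let mkL (g : {mfun T >-> measurableTypeR R}) : {mfun_ mu, T >-> measurableTypeR R} :=
  (\pi_({mfun_ mu, T >-> measurableTypeR R}) g)%qT.

Let ae_pi (g : {mfun T >-> measurableTypeR R}) : (mkL g : T -> R) = g %[ae mu].
Proof.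
have /eqP := reprK (mkL g); rewrite /mkL.
by rewrite eqmodE => /asboolP.
Qed.

Let Lclass_of_Lfun (f : LfunType mu p1) : exists u : L, (u : T -> R) = f %[ae mu].
Proof.
have mf : (f : T -> measurableTypeR R) \in mfun by rewrite inE; apply: (@measurable_funPT _ _ _ _ f).
pose u := mkL (mfun_Sub mf).
have fin_u : finite_norm mu p u.
  rewrite /finite_norm (ae_eq_Lnorm _ _ (ae_pi (mfun_Sub mf)))//.
  - exact: Lfunction_finite.
  - apply: (@measurable_funPT _ _ _ _ (repr u)).
exists (LebesgueSpace.Pack (LebesgueSpace.Class (isFinLebesgue.Build d T R mu p p1 u fin_u))).
exact: (ae_pi (mfun_Sub mf)).
Qed.

HB.instance Definition _ := gen_eqMixin L.
HB.instance Definition _ := gen_choiceMixin L.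

(* The class of [f] when [f] is in L^p, and a fixed junk class otherwise. *)
Definition Lclass (f : T -> R) : L :=
  xget (sval (cid (Lclass_of_Lfun 0))) [set u : L | (u : T -> R) = f %[ae mu]].

Lemma LclassE (f : T -> R) : f \in Lfun mu p -> (Lclass f : T -> R) = f %[ae mu].
Proof.
move=> fp; rewrite /Lclass; case: xgetP => // none.
by have [u uf] := Lclass_of_Lfun (Lfun_Sub p1 fp); case: (none u).
Qed.

Lemma Lspace_measurable (u : L) : measurable_fun setT (u : T -> R).
Proof. exact: (@measurable_funPT _ _ _ _ (repr (LebesgueSpace.sort u))). Qed.

Lemma Lspace_Lfun (u : L) : (u : T -> R) \in Lfun mu p.
Proof.
apply/andP; split; rewrite inE; first exact: Lspace_measurable.
exact: Lebesgue_finite.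
Qed.

Lemma Lspace_ext (u v : L) : (u : T -> R) = v %[ae mu] -> u = v.
Proof.
case: u v => [u [[fu]]] [v [[fv]]] /= uv.
have uv' : u = v by rewrite -(reprK u) -(reprK v); apply/eqP; rewrite eqmodE; apply/asboolP.
by case: v / uv' fv {uv} => fv; rewrite (Prop_irrelevance fu fv).
Qed.

Lemma Lclass_ae (f g : T -> R) : f = g %[ae mu] -> Lclass f = Lclass g.
Proof.
move=> fg; rewrite /Lclass; congr xget; apply/seteqP; split=> u /= uf.
  exact: ae_eq_trans uf fg.
exact: ae_eq_trans uf (ae_eq_sym fg).
Qed.

Lemma Lclass_id (u : L) : Lclass u = u.
Proof. by apply: Lspace_ext; apply: LclassE; exact: Lspace_Lfun. Qed.

Lemma Lfun_add (f g : T -> R) : f \in Lfun mu p -> g \in Lfun mu p -> (f \+ g) \in Lfun mu p.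
Proof. by move=> fp gp; exact: (@rpredD _ (Lfun mu p) f g). Qed.

Lemma Lfun_scal (a : R) (f : T -> R) : f \in Lfun mu p -> (fun x => a * f x) \in Lfun mu p.
Proof. by move=> fp; exact: (@rpredZ _ _ (Lfun mu p) a f). Qed.

Lemma Lfun_opp (f : T -> R) : f \in Lfun mu p -> (fun x => - f x) \in Lfun mu p.
Proof. by move=> fp; exact: (@Lfun_oppr_closed _ _ _ mu p f). Qed.

Lemma Lfun_0 : (cst 0 : T -> R) \in Lfun mu p.
Proof. exact: (LfunP (0 : LfunType mu p1)). Qed.

Let Ladd (u v : L) := Lclass (u \+ v).
Let Lopp (u : L) := Lclass (fun x => - u x).
Let Lscale (a : R) (u : L) := Lclass (fun x => a * u x).

Let LaddE (u v : L) : (Ladd u v : T -> R) = u \+ v %[ae mu].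
Proof. by apply: LclassE; apply: Lfun_add; exact: Lspace_Lfun. Qed.
Let LoppE (u : L) : (Lopp u : T -> R) = (fun x => - u x) %[ae mu].
Proof. by apply: LclassE; apply: Lfun_opp; exact: Lspace_Lfun. Qed.
Let LscaleE (a : R) (u : L) : (Lscale a u : T -> R) = (fun x => a * u x) %[ae mu].
Proof. by apply: LclassE; apply: Lfun_scal; exact: Lspace_Lfun. Qed.
Let L0E : (Lclass (cst 0) : T -> R) = cst 0 %[ae mu].
Proof. by apply: LclassE; exact: Lfun_0. Qed.

Let LaddA : associative Ladd.
Proof.
move=> u v w; apply: Lclass_ae; have := LaddE v w; have := LaddE u v.
by apply: filterS2 => x /(_ I) uv /(_ I) vw _ /=; rewrite uv vw /= addrA.
Qed.
Let LaddC : commutative Ladd.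
Proof. by move=> u v; apply: Lclass_ae; apply: aeW => x _ /=; rewrite addrC. Qed.
Let Ladd0 : left_id (Lclass (cst 0)) Ladd.
Proof.
move=> u; rewrite -[RHS]Lclass_id; apply: Lclass_ae.
by apply: filterS L0E => x /(_ I) /= -> _; rewrite add0r.
Qed.
Let LaddN : left_inverse (Lclass (cst 0)) Lopp Ladd.
Proof.
move=> u; apply: Lclass_ae; have := LoppE u.
by apply: filterS => x /(_ I) /= -> _; rewrite addNr.
Qed.
HB.instance Definition _ := GRing.isZmodule.Build L LaddA LaddC Ladd0 LaddN.

Lemma Lspace0E : ((0 : L) : T -> R) = cst 0 %[ae mu].
Proof. exact: L0E. Qed.
Lemma LspaceDE (u v : L) : (u + v : T -> R) = u \+ v %[ae mu].
Proof. exact: LaddE. Qed.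
Lemma LspaceNE (u : L) : (- u : T -> R) = (fun x => - u x) %[ae mu].
Proof. exact: LoppE. Qed.

Let LscaleA (a b : R) (u : L) : Lscale a (Lscale b u) = Lscale (a * b) u.
Proof.
apply: Lclass_ae; have := LscaleE b u.
by apply: filterS => x /(_ I) /= -> _; rewrite mulrA.
Qed.
Let Lscale1 : left_id 1 Lscale.
Proof.
move=> u; rewrite -[RHS]Lclass_id; apply: Lclass_ae.
by apply: aeW => x _ /=; rewrite mul1r.
Qed.
Let LscaleDr : right_distributive Lscale +%R.
Proof.
move=> a u v; apply: Lclass_ae.
have uv := LspaceDE u v; have := LscaleE a u; have := LscaleE a v.
apply: filterS3 uv => x /(_ I) /= -> /(_ I) -> /(_ I) -> _.
by rewrite mulrDr.
Qed.
Let LscaleDl (u : L) : {morph Lscale^~ u : a b / a + b}.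
Proof.
move=> a b; apply: Lclass_ae; have := LscaleE a u; have := LscaleE b u.
by apply: filterS2 => x /(_ I) /= -> /(_ I) -> _; rewrite mulrDl.
Qed.
HB.instance Definition _ :=
  GRing.Zmodule_isLmodule.Build R L LscaleA Lscale1 LscaleDr LscaleDl.

Lemma LspaceZE (a : R) (u : L) : (a *: u : T -> R) = (fun x => a * u x) %[ae mu].
Proof. exact: LscaleE. Qed.

Let Lnm (u : L) : R := fine ('N[mu]_p[EFin \o u])%E.

Let LfunOf (u : L) : LfunType mu p1 := Lfun_Sub p1 (Lspace_Lfun u).

Let LnmE (u : L) (f : LfunType mu p1) : (u : T -> R) = f %[ae mu] ->
  Lnm u = fine ('N[mu]_p[EFin \o f])%E.
Proof.
move=> uf; rewrite /Lnm (ae_eq_Lnorm _ _ uf)//; exact: Lspace_measurable.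
Qed.

Let LnmD (u v : L) : Lnm (u + v) <= Lnm u + Lnm v.
Proof.
rewrite (@LnmE (u + v) (LfunOf u + LfunOf v)); last exact: LspaceDE.
exact: ler_LnormD.
Qed.
Let LnmZ (a : R) (u : L) : Lnm (a *: u) = `|a| * Lnm u.
Proof.
rewrite (@LnmE (a *: u) (a *: LfunOf u)); last exact: LspaceZE.
apply: EFin_inj; rewrite EFinM finite_norm_fine.
by rewrite (finite_norm_fine (LfunOf u)) -LnormZ.
Qed.
Let Lnm_eq0 (u : L) : Lnm u = 0 -> u = 0.
Proof.
move=> /(@fine_Lnormr_eq0 _ _ _ _ _ p1 (LfunOf u)) u0.
by apply: Lspace_ext; apply: ae_eq_trans u0 (ae_eq_sym Lspace0E).
Qed.
HB.instance Definition _ := Lmodule_isNormed.Build R L LnmD LnmZ Lnm_eq0.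

Lemma Lspace_normE (u : L) : `|u| = fine ('N[mu]_p[EFin \o u])%E.
Proof. by []. Qed.

End LspaceStructure.

(* C_b(T) with the sup norm. *)
Section BoundedContinuous.
Context (T : ptopologicalType) (R : realType).

Definition bounded_continuous (f : T -> R) :=
  continuous f /\ exists M, forall x, `|f x| <= M.

Record bcfun := BCfun {
  bcfun_val :> T -> R ;
  bcfunP : bounded_continuous bcfun_val }.

HB.instance Definition _ := gen_eqMixin bcfun.
HB.instance Definition _ := gen_choiceMixin bcfun.

Lemma bcfun_ext (f g : bcfun) : f =1 g -> f = g.
Proof.
case: f g => [f fP] [g gP] /= /funext fg; case: g / fg gP => gP.
by rewrite (Prop_irrelevance fP gP).
Qed.

Lemma bounded_continuous0 : bounded_continuous (cst 0).
Proof.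
split; first by move=> x; exact: cvg_cst.
by exists 0 => x /=; rewrite normr0.
Qed.

Lemma bounded_continuousD (f g : T -> R) : bounded_continuous f ->
  bounded_continuous g -> bounded_continuous (fun x => f x + g x).
Proof.
move=> [cf [M fM]] [cg [N gN]]; split.
  by move=> x; apply: cvgD; [exact: cf|exact: cg].
by exists (M + N) => x; rewrite (le_trans (ler_normD _ _))// lerD.
Qed.

Lemma bounded_continuousZ (a : R) (f : T -> R) : bounded_continuous f ->
  bounded_continuous (fun x => a * f x).
Proof.
move=> [cf [M fM]]; split; first by move=> x; apply: cvgMr; exact: cf.
by exists (`|a| * M) => x; rewrite normrM ler_wpM2l.
Qed.

Lemma bounded_continuousN (f : T -> R) : bounded_continuous f ->
  bounded_continuous (fun x => - f x).
Proof.
move=> [cf [M fM]]; split; first by move=> x; apply: cvgN; exact: cf.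
by exists M => x; rewrite normrN.
Qed.

Let Badd (f g : bcfun) := BCfun (bounded_continuousD (bcfunP f) (bcfunP g)).
Let Bopp (f : bcfun) := BCfun (bounded_continuousN (bcfunP f)).
Let Bscale (a : R) (f : bcfun) := BCfun (bounded_continuousZ a (bcfunP f)).
Let B0 := BCfun bounded_continuous0.

Let BaddA : associative Badd.
Proof. by move=> f g h; apply: bcfun_ext => x /=; rewrite addrA. Qed.
Let BaddC : commutative Badd.
Proof. by move=> f g; apply: bcfun_ext => x /=; rewrite addrC. Qed.
Let Badd0 : left_id B0 Badd.
Proof. by move=> f; apply: bcfun_ext => x /=; rewrite add0r. Qed.
Let BaddN : left_inverse B0 Bopp Badd.
Proof. by move=> f; apply: bcfun_ext => x /=; rewrite addNr. Qed.
HB.instance Definition _ := GRing.isZmodule.Build bcfun BaddA BaddC Badd0 BaddN.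

Let BscaleA (a b : R) (f : bcfun) : Bscale a (Bscale b f) = Bscale (a * b) f.
Proof. by apply: bcfun_ext => x /=; rewrite mulrA. Qed.
Let Bscale1 : left_id 1 Bscale.
Proof. by move=> f; apply: bcfun_ext => x /=; rewrite mul1r. Qed.
Let BscaleDr : right_distributive Bscale +%R.
Proof. by move=> a f g; apply: bcfun_ext => x /=; rewrite mulrDr. Qed.
Let BscaleDl (f : bcfun) : {morph Bscale^~ f : a b / a + b}.
Proof. by move=> a b; apply: bcfun_ext => x /=; rewrite mulrDl. Qed.
HB.instance Definition _ :=
  GRing.Zmodule_isLmodule.Build R bcfun BscaleA Bscale1 BscaleDr BscaleDl.

Definition sup_norm (f : bcfun) : R := sup [set `|f x| | x in [set: T]].

Lemma sup_norm_ub (f : bcfun) (x : T) : `|f x| <= sup_norm f.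
Proof.
apply: ub_le_sup; last by exists x.
by have [_ [M fM]] := bcfunP f; exists M => _ [y _ <-].
Qed.

Lemma sup_norm_le (f : bcfun) (M : R) : (forall x, `|f x| <= M) -> sup_norm f <= M.
Proof.
move=> fM; apply: ge_sup; first by exists `|f point|, point.
by move=> _ [x _ <-].
Qed.

Let sup_normD (f g : bcfun) : sup_norm (f + g) <= sup_norm f + sup_norm g.
Proof.
apply: sup_norm_le => x.
by rewrite (le_trans (ler_normD _ _))// lerD// sup_norm_ub.
Qed.
Let sup_normZ (a : R) (f : bcfun) : sup_norm (a *: f) = `|a| * sup_norm f.
Proof.
have le_normZ (b : R) (g : bcfun) : sup_norm (b *: g) <= `|b| * sup_norm g.
  by apply: sup_norm_le => x; rewrite normrM ler_wpM2l ?sup_norm_ub.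
apply/eqP; rewrite eq_le le_normZ /=.
have [->|a0] := eqVneq a 0.
  by rewrite normr0 mul0r (le_trans _ (sup_norm_ub _ point)).
rewrite -ler_pdivlMl ?normr_gt0// -normfV.
by rewrite -{1}[f](scalerK a0) le_normZ.
Qed.
Let sup_norm_eq0 (f : bcfun) : sup_norm f = 0 -> f = 0.
Proof.
move=> f0; apply: bcfun_ext => x /=; apply/eqP; rewrite -normr_le0 -f0.
exact: sup_norm_ub.
Qed.
HB.instance Definition _ :=
  Lmodule_isNormed.Build R bcfun sup_normD sup_normZ sup_norm_eq0.

Lemma bcfun_normE (f : bcfun) : `|f| = sup [set `|f x| | x in [set: T]].
Proof. by []. Qed.

End BoundedContinuous.

Section OperatorsAndSemigroups.
Context (R : realType).

Definition op_norm (E F : normedModType R) (f : E -> F) : \bar R :=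
  ereal_sup [set (`|f u|)%:E | u in [set u : E | `|u| <= 1]].

Definition compact_operator (E F : normedModType R) (f : E -> F) :=
  forall B : set E, bounded_set B -> precompact (f @` B).

(* e^(tA) u as the sum of its exponential series; for a bounded operator A on
   a Banach space the series converges absolutely for every real t. *)
Definition exp_group (E : normedModType R) (A : E -> E) (t : R) (u : E) : E :=
  limn (series (fun n => (t ^+ n / n`!%:R) *: iter n A u)).

(* Classical solution of u' = A u for t > 0, u(0) = u0. *)
Definition solves (E : normedModType R) (A : E -> E) (u0 : E) (u : R -> E) :=
  [/\ {within `[0, +oo[, continuous u},
      u 0 = u0 &
      forall t : R, 0 < t -> is_derive t 1 u (A (u t))].

(* [edist_inf set0] is +oo, so a set attracting a nonempty set is nonempty. *)
Definition attracts (E : normedModType R) (S : R -> E -> E) (C B : set E) :=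
  ereal_sup [set edist_inf C (S t b) | b in B] @[t --> +oo%R] --> 0%E.

Definition asymptotically_smooth (E : normedModType R) (S : R -> E -> E) :=
  forall B : set E, B !=set0 -> closed B -> bounded_set B ->
    (forall t, 0 <= t -> S t @` B `<=` B) ->
  exists C : set E, [/\ compact C, C `<=` B & attracts S C B].

End OperatorsAndSemigroups.

#[short(type="metricMeasurableType")]
HB.structure Definition MetricMeasurable (d : measure_display) (R : realType) :=
  {T of Metric R T & Measurable d T}.

Section MetricMeasureSpace.
Context d (R : realType) (T : metricMeasurableType d R).
Variable mu : {measure set T -> \bar R}.

(* Every measurable set is outer regular by open sets and inner regular by
   compact sets. *)
Definition regular_measure := forall A : set T, measurable A ->
  mu A = ereal_inf [set mu U | U in [set U : set T | open U /\ A `<=` U]] /\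
  mu A = ereal_sup [set mu C | C in [set C : set T | compact C /\ C `<=` A]].

(* The sigma-algebra may be larger than the Borel one, as completeness of the
   measure requires in general. *)
Record metric_measure_space : Prop := {
  mms_borel : forall U : set T, open U -> measurable U ;
  mms_sigma_finite : sigma_finite setT mu ;
  mms_regular : regular_measure ;
  mms_complete : measure_is_complete mu ;
  mms_ball : forall (x : T) (r : R), 0 < r -> (0 < mu (ball x r) < +oo)%E }.

(* The two choices of X, L^q with p <= q and C_b. *)
Inductive target (p : \bar R) :=
| TargetLq (q : \bar R) (q1 : (1 <= q)%E) (pq : (p <= q)%E)
| TargetCb.

Variables (p : \bar R) (p1 : (1 <= p)%E).
Local Notation Lp := (LspaceType mu p1).

Definition target_space (X : target p) : normedModType R :=
  match X with
  | TargetLq _ q1 _ => LspaceType mu q1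
  | TargetCb => bcfun T R
  end.

Definition target_fun (X : target p) : target_space X -> T -> R :=
  match X with
  | TargetLq _ q1 _ => fun v : LspaceType mu q1 => (v : T -> R)
  | TargetCb => fun v : bcfun T R => (v : T -> R)
  end.

(* "For all x" for pointwise identities between elements of X: almost
   everywhere in L^q, everywhere in C_b. *)
Definition target_forall (X : target p) (P : T -> Prop) : Prop :=
  match X with
  | TargetLq _ _ _ => {ae mu, forall x, P x}
  | TargetCb => forall x, P x
  end.

Definition target_coef (X : target p) (h : T -> R) : Prop :=
  match X with
  | TargetLq _ _ _ => h \in Lfun mu +oo
  | TargetCb => bounded_continuous h
  end.

(* The inclusion of X in L^p; when [mu] is finite and Borel sets are measurable,
   [target_fun v] is in L^p, so the junk case of [Lclass] does not occur. *)
Definition target_embed (X : target p) (v : target_space X) : Lp :=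
  Lclass mu p1 (target_fun v).

(* K u(x) is the integral of J(x, y) u(y) dy, which is required to be
   well defined. *)
Definition kernel_operator (J : T -> T -> R) (X : target p)
    (K : Lp -> target_space X) :=
  forall u : Lp, target_forall X (fun x =>
    mu.-integrable setT (fun y => (J x y * u y)%:E) /\
    target_fun (K u) x = \int[mu]_y (J x y * u y)).

(* Multiplication by an essentially bounded [h], which preserves L^p. *)
Definition mul_operator (h : T -> R) (u : Lp) : Lp :=
  Lclass mu p1 (fun x => h x * u x).

Definition nonlocal_operator (X : target p) (K : Lp -> target_space X)
    (h : T -> R) (u : Lp) : Lp :=
  target_embed (K u) - mul_operator h u.

End MetricMeasureSpace.

(* Main.v *)
From HB Require Import structures.
Require Import Defs.
From mathcomp Require Import all_boot all_order all_algebra.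
From mathcomp Require Import all_classical all_reals all_analysis.
From mathcomp Require Import ess_sup_inf measurable_realfun.
From mathcomp Require Import lra ring.

(** Write [A = iota K - H], where [H] is the multiplication by [h] on [L^p],
    [K] is the integral operator from [L^p] to [X], and [iota] is the inclusion
    of [X] in [L^p]. Everything is read off the exponential series.

    Let [N = - H], and let [NX] be the multiplication by [- h] on [X], so that
    [iota NX = N iota]. By induction on [n],
        A^n = N^n + iota B_n,   B_0 = 0,   B_(n+1) = K A^n + NX B_n
    (lemma [iter_pert]). Summing against [t^n / n!] gives the splitting
    [S(t) = S_1(t) + iota S_2(t)] with [S_1(t) = e^(tN)] and
    [S_2(t) = sum_n t^n / n! B_n], the latter being a series of operators
    from [L^p] to [X]. Each [B_n] is compact since [K] is, and the series
    converges in operator norm, so that [S_2(t)] is compact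
    ([totally_bounded_expsum], [pert_exp_compact]). The series stands for
    the Duhamel integral of [e^(N(t-s)) K S(s)].

    Decay and uniqueness both come from one growth estimate ([growth_bound]):
    if [v' = D] and [|v(t) - r D(t)| >= (1 - r w) |v(t)|] for all [r > 0], then
    [|v(t)| <= e^(w't) |v(0)|] for every [w' > w]. With [w = |A|] applied to
    the difference of two solutions this is uniqueness for [u' = A u]
    ([ode_unique]). Since [|(1 + r h) u| >= (1 + r alpha) |u|] pointwise, the
    estimate with [w = - alpha] applies to [u' = - H u] and gives
    [|S_1(t)| <= e^(- alpha t / 2)] ([mul_operator_expansive],
    [dissipative_decay]).

    For asymptotic smoothness, let [B] be closed, bounded and invariant. The
    sets [S(t) B] decrease, and for every [e] one of them has a finite [e]-net:
    it lies in the sum of a small ball, coming from [S_1], and of a totally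
    bounded set, coming from [S_2]. As in Kuratowski's theorem on decreasing
    sets whose measure of noncompactness tends to [0], the intersection of the
    closures of the [S(t) B] is compact and attracts [B]
    ([ultra_omega_limit], [compact_omega_limit], [omega_limit_attracts]).

    These arguments live in Banach spaces, so the concrete part of the proof is
    that [L^p] ([Lspace_complete]) and [C_b] ([bcfun_complete]) are complete,
    and that [X] embeds continuously in [L^p] when the measure is finite
    ([Lspace_incl_bounded], [bcfun_embed_bounded]). *)

Set Implicit Arguments.
Unset Strict Implicit.
Unset Printing Implicit Defensive.

Import Order.TTheory GRing.Theory Num.Theory.
Import numFieldNormedType.Exports.

Local Open Scope classical_set_scope.
Local Open Scope ring_scope.

(** * Completeness of normed modules *)

Section Completeness.
Context (R : realType).
Implicit Types E F : normedModType R.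

(** A predicate rather than the library structure of complete normed modules:
    the target space is defined by cases, and carries only the structure of a
    normed module. *)
Definition complete_space E :=
  forall F : set_system E, ProperFilter F -> cauchy F -> cvg F.

Lemma complete_normed_cvg E (x : E^nat) : complete_space E ->
  cvgn [normed series x] -> cvgn (series x).
Proof.
move=> cE /cauchy_cvgP/cauchy_seriesP xN.
apply: (cE (series x @ \oo)); apply/cauchy_seriesP => e /xN.
apply: filterS => n /=; rewrite ger0_norm ?sumr_ge0//.
by apply: le_lt_trans; apply: ler_norm_sum.
Qed.

(** A Cauchy filter contains balls of radius [2^-n]; their centers form a
    sequence with absolutely summable increments, and the filter converges to
    the limit of that sequence. *)
Lemma complete_of_series E :
  (forall x : E^nat, cvgn [normed series x] -> cvgn (series x)) ->
  complete_space E.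
Proof.
move=> cE F FF /cauchyP Fc.
have /choice [x Fx] : forall n, exists x, F (ball x (2^-1 ^+ n)).
  by move=> n; apply: Fc; rewrite exprn_gt0.
pose y n := x n.+1 - x n.
have yn n : `|y n| <= 2 * 2^-1 ^+ n.
  have [z [zn zn1]] := filter_ex (filterI (Fx n) (Fx n.+1)).
  move: zn zn1; rewrite -!ball_normE /= exprS => zn zn1.
  rewrite /y (le_trans (ler_distD z _ _))// [`|z - _|]distrC.
  move: zn zn1; have : 0 < 2^-1 ^+ n :> R by rewrite exprn_gt0.
  lra.
have /cE : cvgn [normed series y].
  have : cvgn (series (geometric 2 (2^-1 : R))).
    by apply: is_cvg_geometric_series; rewrite ger0_norm// invf_lt1// ltr1n.
  by apply: series_le_cvg => //= n; rewrite mulr_ge0// exprn_ge0.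
rewrite (telescopeK x : series y = _).
move=> /cvg_ex [l yl].
apply/cvg_ex; exists (l + x 0); apply/cvg_ballP => e e0.
have e20 : 0 < e / 2 by rewrite divr_gt0.
have xl : \forall n \near \oo, `|l - (x n - x 0)| < e / 2.
  by move/cvgrPdist_lt : yl; apply.
have x0 : \forall n \near \oo, `|0 - 2^-1 ^+ n : R| < e / 2.
  have : 2^-1 ^+ n @[n --> \oo] --> (0 : R).
    by apply: cvg_expr; rewrite ger0_norm// invf_lt1// ltr1n.
  by move/cvgrPdist_lt; apply.
near \oo => n.
have : F (ball (x n) (2^-1 ^+ n)) by [].
apply: filterS => z; rewrite -!ball_normE /= => xz.
have -> : l + x 0 - z = (l - (x n - x 0)) + (x n - z).
  by rewrite opprB !addrA subrK.

rewrite (le_lt_trans (ler_normD _ _))//.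
have h1 : `|l - (x n - x 0)| < e / 2 by near: n.
have h2 : `|0 - 2^-1 ^+ n : R| < e / 2 by near: n.
move: h2; rewrite sub0r normrN ger0_norm ?exprn_ge0//.
by move: h1 xz; lra.
Unshelve. all: by end_near. Qed.

End Completeness.

(** * Finite nets and compactness *)

Section TotallyBounded.
Context (R : realType).
Implicit Types E F : normedModType R.

Definition finite_net E (e : R) (A : set E) :=
  exists s : seq E, forall a, A a -> exists2 c, c \in s & `|c - a| < e.

Definition totally_bounded E (A : set E) := forall e, 0 < e -> finite_net e A.

Lemma finite_netS E e (A B : set E) :
  A `<=` B -> finite_net e B -> finite_net e A.
Proof. by move=> AB [s sB]; exists s => a /AB/sB. Qed.

Lemma totally_boundedS E (A B : set E) :
  A `<=` B -> totally_bounded B -> totally_bounded A.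
Proof. by move=> AB tB e /tB; exact: finite_netS. Qed.

(** Of finitely many sets that cover a member of an ultrafilter, one belongs to
    the ultrafilter. This turns finite nets into Cauchy ultrafilters, and
    replaces the extraction of subsequences. *)
Lemma ultra_finite_net E e (A : set E) (F : set_system E) : UltraFilter F ->
  F A -> finite_net e A -> exists x, F (ball x e).
Proof.
move=> FU FA [s sA].
have {FA sA} : F [set a | exists2 c, c \in s & `|c - a| < e].
  by apply: filterS FA.
elim: s => [|c s IH] FA.
  have /filter_ex [] : F set0 by apply: filterS FA => a [].
  by [].
have [|FC] := in_ultra_setVsetC (ball c e) FU; first by exists c.
apply: IH; apply: filterS2 FA FC => a [b + ba] nca.
rewrite inE => /orP[/eqP bc|bs]; last by exists b.
by exfalso; apply: nca; rewrite -ball_normE /= -bc.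
Qed.

Lemma finite_net_closure E e (A : set E) : 0 < e -> finite_net e A ->
  finite_net (e + e) (closure A).
Proof.
move=> e0 [s sA]; exists s => a /(_ (ball a e)) [|b [/sA [c cs cb]]].
  exact: nbhsx_ballx.
rewrite -ball_normE /= => ab; exists c => //.
by rewrite (le_lt_trans (ler_distD b _ _))// [`|b - a|]distrC ltrD.
Qed.

Lemma totally_bounded_precompact E (A : set E) : complete_space E ->
  totally_bounded A -> precompact A.
Proof.
move=> cE tA; rewrite precompactE compact_ultra /= => F FU FA.
have /cE : cauchy F.
  apply/cauchyP => e e0; have e20 : 0 < e / 2 by rewrite divr_gt0.
  have /(ultra_finite_net FU FA) := finite_net_closure e20 (tA _ e20).
  by rewrite -splitr.
move=> /cvg_ex[l Fl]; exists l; split => //.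
rewrite (closure_id (closure A)).1; last exact: closed_closure.
by move=> B /Fl FB; exact: (filter_ex (filterI FA FB)).
Qed.

Lemma precompact_totally_bounded E (A : set E) :
  precompact A -> totally_bounded A.
Proof.
rewrite precompactE compact_cover => cA e e0.
have [|a Aa|D DA AD] := cA E (closure A) (fun x => ball x e).
- by move=> x _; exact: ball_open.
- by exists a => //; exact: ballxx.
exists (finmap.enum_fset D) => a /subset_closure /AD [c /= cD].
by rewrite -ball_normE /= => ca; exists c.
Qed.

Lemma totally_boundedD E (A B C : set E) :
  (forall x, C x -> exists a b, [/\ A a, B b & x = a + b]) ->
  totally_bounded A -> totally_bounded B -> totally_bounded C.
Proof.
move=> CAB tA tB e e0; have e20 : 0 < e / 2 by rewrite divr_gt0.
have [s sA] := tA _ e20; have [r rB] := tB _ e20.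
exists [seq a + b | a <- s, b <- r] => x /CAB[a [b []]].
move=> /sA[c cs ca] /rB[d dr db] ->.
exists (c + d); first by apply/allpairsP; exists (c, d).
by rewrite opprD addrACA (le_lt_trans (ler_normD _ _))// [e]splitr ltrD.
Qed.

(** Total boundedness passes to uniform limits; this is why a limit of compact
    operators in operator norm is compact. *)
Lemma totally_bounded_approx E (A : set E) :
  (forall e, 0 < e -> exists2 B, totally_bounded B &
     forall a, A a -> exists2 b, B b & `|b - a| <= e) -> totally_bounded A.
Proof.
move=> h e e0; have e20 : 0 < e / 2 by rewrite divr_gt0.
have [B tB AB] := h _ e20; have [s sB] := tB _ e20.
exists s => a /AB[b /sB[c cs cb] ba]; exists c => //.
by rewrite (le_lt_trans (ler_distD b _ _))// [e]splitr ltr_leD.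
Qed.

Lemma totally_bounded_image E F (f : {linear E -> F}) k (A : set E) :
  (forall u, `|f u| <= k * `|u|) -> totally_bounded A ->
  totally_bounded (f @` A).
Proof.
move=> fk tA e e0.
have k0 : 0 < `|k| + 1 by rewrite ltr_wpDl.
have [s sA] := tA _ (divr_gt0 e0 k0).
exists (map f s) => _ [a /sA[c cs ca] <-]; exists (f c); first exact: map_f.
rewrite -linearB (le_lt_trans (fk _))//.
rewrite (@le_lt_trans _ _ ((`|k| + 1) * `|c - a|))//.
  by rewrite ler_wpM2r// (le_trans (ler_norm _))// lerDl.
by rewrite mulrC -ltr_pdivlMr.
Qed.

Lemma bounded_setP E (B : set E) :
  bounded_set B <-> exists M, forall u, B u -> `|u| <= M.
Proof.
split=> [/pinfty_ex_gt0[M _ BM]|[M BM]]; first by exists M.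
rewrite /bounded_set /= /bounded_near; near=> N => u /= /BM uM.
by rewrite (le_trans uM)//; near: N; apply: nbhs_pinfty_ge; exact: num_real.
Unshelve. all: by end_near. Qed.

(** For operators into a complete space, compactness can be tested on balls and
    expressed with finite nets, which are stable under sums and uniform
    limits. *)
Lemma compact_operatorP E F (f : E -> F) : complete_space F ->
  compact_operator f <->
  forall rho, totally_bounded (f @` [set u | `|u| <= rho]).
Proof.
move=> cF; split=> [cf rho|tf B /bounded_setP[M BM]].
  by apply/precompact_totally_bounded/cf/bounded_setP; exists rho.
apply: totally_bounded_precompact => //.
apply: totally_boundedS (tf M) => _ [u Bu <-]; exists u => //=.
exact: BM.
Qed.

End TotallyBounded.

(** * Exponential series of vectors *)

Section ExpSum.
Context (R : realType).
Implicit Types E F : normedModType R.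

Lemma dominated_series_cvg E (x : E^nat) (v : R^nat) : complete_space E ->
  (forall n, `|x n| <= v n) -> cvgn (series v) -> cvgn (series x).
Proof.
move=> cE xv cv; apply: complete_normed_cvg => //.
by apply: series_le_cvg cv => //= n; apply: le_trans (xv n).
Qed.

(** The estimate passes to the limit from
    [|sum_(N <= k < n) x_k| <= sum_(N <= k < n) v_k]. *)
Lemma dominated_series_tail E (x : E^nat) (v : R^nat) N : complete_space E ->
  (forall n, `|x n| <= v n) -> cvgn (series v) ->
  `|limn (series x) - series x N| <= limn (series v) - series v N.
Proof.
move=> cE xv cv; have cx := dominated_series_cvg cE xv cv.
have cl : `|series x n - series x N| @[n --> \oo] -->
    `|limn (series x) - series x N|.
  by apply: cvg_norm; apply: cvgB => //; exact: cvg_cst.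
have cr : series v n - series v N @[n --> \oo] -->
    limn (series v) - series v N.
  by apply: cvgB => //; exact: cvg_cst.
rewrite -(cvg_lim _ cl)// -(cvg_lim _ cr)//.
apply: ler_lim; [exact: cvgP cl|exact: cvgP cr|].
near=> n; have Nn : (N <= n)%N by near: n; exact: nbhs_infty_ge.
rewrite !sub_series Nn (le_trans (ler_norm_sum _ _ _))//.
exact: ler_sum.
Unshelve. all: by end_near. Qed.

(** The value at [t] of the exponential generating function of [x]. With
    [x n = iter n A u] this is the exponential group of [A] at [u]; the
    compact part of the group is of the same form, for other coefficients. *)
Definition expsum E (x : E^nat) (t : R) : E :=
  limn (series (fun n => (t ^+ n / n`!%:R) *: x n)).

Definition exp_bounded E (c L : R) (x : E^nat) :=
  forall n, `|x n| <= c * L ^+ n.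

Section OneSequence.
Context (E : normedModType R) (cE : complete_space E) (c L : R).
Implicit Type x : E^nat.

(** General coefficients [a n], because besides the powers [t ^+ n] the
    remainders of their first-order expansions are used, for the
    derivative. *)
Lemma exp_term_le x (a : R^nat) (b k : R) : exp_bounded c L x -> 0 <= k ->
  (forall n, `|a n| <= k * b ^+ n) ->
  forall n, `|(a n / n`!%:R) *: x n| <= k * c * exp_coeff (b * L) n.
Proof.
move=> xc k0 ab n; rewrite normrZ normrM normfV [`|n`!%:R|]ger0_norm//.
rewrite /exp_coeff /= exprMn.
rewrite (_ : k * c * _ = (k * b ^+ n / n`!%:R) * (c * L ^+ n)); last by ring.
by rewrite ler_pM// ?mulr_ge0 ?invr_ge0// ler_wpM2r ?invr_ge0.
Qed.

Lemma cvg_exp_coeffZ (k b : R) :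
  series (fun n => k * exp_coeff b n) @ \oo --> k * expR b.
Proof.
rewrite (seriesZ (exp_coeff b) k : series (fun n => _) = _).
by apply: cvgMr; exact: is_cvg_series_exp_coeff.
Qed.
Arguments cvg_exp_coeffZ : clear implicits.

Lemma exp_series_cvg x (a : R^nat) (b k : R) : exp_bounded c L x -> 0 <= k ->
  (forall n, `|a n| <= k * b ^+ n) ->
  cvgn (series (fun n => (a n / n`!%:R) *: x n)).
Proof.
move=> xc k0 ab.
apply: (dominated_series_cvg cE (exp_term_le xc k0 ab)).
exact: (cvgP _ (cvg_exp_coeffZ (k * c) (b * L))).
Qed.

Lemma exp_series_norm x (a : R^nat) (b k : R) : exp_bounded c L x -> 0 <= k ->
  (forall n, `|a n| <= k * b ^+ n) ->
  `|limn (series (fun n => (a n / n`!%:R) *: x n))| <= k * c * expR (b * L).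
Proof.
move=> xc k0 ab.
have cv := cvg_exp_coeffZ (k * c) (b * L).
have := dominated_series_tail 0 cE (exp_term_le xc k0 ab) (cvgP _ cv).
by rewrite (cvg_lim _ cv)// /series /= !big_geq// !subr0.
Qed.

Let pow_le (t : R) n : `|t ^+ n| <= 1 * `|t| ^+ n.
Proof. by rewrite normrX mul1r. Qed.

Lemma expsum_cvg x t : exp_bounded c L x ->
  series (fun n => (t ^+ n / n`!%:R) *: x n) @ \oo --> expsum x t.
Proof. by move=> xc; exact: (exp_series_cvg xc ler01 (pow_le t)). Qed.

Lemma expsum_norm x t : exp_bounded c L x ->
  `|expsum x t| <= c * expR (`|t| * L).
Proof.
by move=> xc; have := exp_series_norm xc ler01 (pow_le t); rewrite mul1r.
Qed.

Lemma expsum_tail x t N : exp_bounded c L x ->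
  `|expsum x t - series (fun n => (t ^+ n / n`!%:R) *: x n) N| <=
  c * (expR (`|t| * L) - series (exp_coeff (`|t| * L)) N).
Proof.
move=> xc; have cv := cvg_exp_coeffZ (1 * c) (`|t| * L).
have := dominated_series_tail N cE (exp_term_le xc ler01 (pow_le t)) (cvgP _ cv).
by rewrite (cvg_lim _ cv)// mul1r (seriesZ _ c : series (fun n => _) = _) mulrBr.
Qed.

Lemma expsum0 x : expsum x 0 = x 0%N.
Proof.
apply: cvg_lim => //; rewrite -cvg_shiftS.
rewrite (_ : (fun n => _) = cst (x 0%N)); first exact: cvg_cst.
apply/funext => n; rewrite /series /= big_nat_recl//= expr0 divr1 scale1r.
by rewrite big1 ?addr0// => i _; rewrite exprS !mul0r scale0r.
Qed.

Lemma expsumP (a : R) x y t : exp_bounded c L x -> exp_bounded c L y ->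
  expsum (fun n => a *: x n + y n) t = a *: expsum x t + expsum y t.
Proof.
move=> xc yc; apply: cvg_lim => //.
rewrite (_ : series _ = fun n =>
    a *: series (fun n => (t ^+ n / n`!%:R) *: x n) n +
    series (fun n => (t ^+ n / n`!%:R) *: y n) n); last first.
  apply/funext => n; rewrite /series /= scaler_sumr -big_split /=.
  by apply: eq_bigr => i _; rewrite scalerDr !scalerA [a * _]mulrC.
by apply: cvgD; [apply: cvgZl_tmp|]; exact: expsum_cvg.
Qed.

End OneSequence.

Section Derivative.
Context (E : normedModType R) (cE : complete_space E) (c L : R).
Implicit Type x : E^nat.

(** The first-order remainder of a power is quadratic in [s], with a constant
    geometric in [n], so that it stays summable against [1 / n!]. *)
Let taylor_pow (t s : R) n :
  `|(t + s) ^+ n - t ^+ n - s * (n%:R * t ^+ n.-1)| <=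
  s ^+ 2 * (2 * (1 + `|t| + `|s|)) ^+ n.
Proof.
set r := 1 + `|t| + `|s|.
have r1 : 1 <= r by rewrite /r -addrA lerDl addr_ge0.
have r0 : 0 <= r by rewrite (le_trans ler01).
have tr : `|t| <= r by rewrite /r -addrA addrCA lerDl addr_ge0.
have tsr : `|t + s| <= r.
  by rewrite (le_trans (ler_normD _ _))// /r -addrA lerDr.
clearbody r.
elim: n => [|n IH].
  by rewrite !expr0 mul0r mulr0 subr0 subrr normr0 mulr1 sqr_ge0.
have -> : (t + s) ^+ n.+1 - t ^+ n.+1 - s * (n.+1%:R * t ^+ n.+1.-1) =
    (t + s) * ((t + s) ^+ n - t ^+ n - s * (n%:R * t ^+ n.-1)) +
    s ^+ 2 * (n%:R * t ^+ n.-1).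
  case: n {IH} => [|n] /=; first by rewrite !expr0 !expr1; ring.
  by rewrite -!natr1 !exprS; ring.
have s20 : 0 <= s ^+ 2 by rewrite sqr_ge0.
rewrite (le_trans (ler_normD _ _))//.
rewrite [`|s ^+ 2 * _|]normrM [`|s ^+ 2|]ger0_norm//.
rewrite [`|(t + s) * _|]normrM [`|n%:R * _|]normrM normr_nat.
have h1 : n%:R * `|t ^+ n.-1| <= (2 * r) ^+ n.
  rewrite exprMn ler_pM//.
    by rewrite -natrX ler_nat ltnW// ltn_expl.
  rewrite normrX (le_trans (lerXn2r _ _ _ tr))//.
  by rewrite ler_weXn2l// leq_pred.
rewrite [leRHS](_ : _ = r * (s ^+ 2 * (2 * r) ^+ n) +
   s ^+ 2 * (r * (2 * r) ^+ n)); last first.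
  by rewrite [(2 * r) ^+ n.+1]exprS; move: ((2 * r) ^+ n) => z; ring.
apply: lerD; first by apply: ler_pM.
apply: ler_wpM2l => //; apply: le_trans h1 _.
by rewrite ler_peMl// exprn_ge0// mulr_ge0.
Qed.

Lemma exp_bounded_shift x : exp_bounded c L x ->
  exp_bounded (c * L) L (fun n => x n.+1).
Proof. by move=> xc n; rewrite -mulrA -exprS. Qed.

Let cvg_shifted x t : exp_bounded c L x ->
  series (fun n => (n%:R * t ^+ n.-1 / n`!%:R) *: x n) @ \oo -->
  expsum (fun n => x n.+1) t.
Proof.
move=> xc; rewrite -cvg_shiftS.
rewrite (_ : (fun n => _) =
    series (fun n => (t ^+ n / n`!%:R) *: x n.+1)); last first.
  apply/funext => n; rewrite /series /= big_nat_recl//= !mul0r scale0r add0r.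
  apply: eq_bigr => i _; rewrite factS natrM; congr (_ *: _).
  by rewrite -mulf_div divff ?mul1r// pnatr_eq0.
exact: expsum_cvg (exp_bounded_shift xc).
Qed.

(** Expanding every power of [t + s] to first order: the linear terms sum to
    the series of the shifted sequence, as [n / n! = 1 / (n - 1)!], and the
    remainders sum to [O(s^2)]. *)
Lemma expsum_taylor x t s : exp_bounded c L x ->
  `|expsum x (t + s) - expsum x t - s *: expsum (fun n => x n.+1) t| <=
  s ^+ 2 * c * expR (2 * (1 + `|t| + `|s|) * L).
Proof.
move=> xc.
have := exp_series_norm cE xc (sqr_ge0 s) (taylor_pow t s).
congr (`|_| <= _); apply: cvg_lim => //.
rewrite (_ : series _ = fun n =>
    series (fun n => ((t + s) ^+ n / n`!%:R) *: x n) n -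
    series (fun n => (t ^+ n / n`!%:R) *: x n) n -
    s *: series (fun n => (n%:R * t ^+ n.-1 / n`!%:R) *: x n) n); last first.
  apply/funext => n; rewrite /series /= scaler_sumr -!sumrB.
  by apply: eq_bigr => i _; rewrite !mulrBl !scalerBl scalerA !mulrA.
apply: cvgB; first by apply: cvgB; exact: expsum_cvg.
by apply: cvgZl_tmp; exact: cvg_shifted.
Qed.

End Derivative.

Lemma is_derive_taylor E (f : R -> E) (t : R) (D : E) (C : R) :
  (forall s, `|s| <= 1 -> `|f (t + s) - f t - s *: D| <= s ^+ 2 * C) ->
  is_derive t 1 f D.
Proof.
move=> fC.
have fD : h^-1 *: ((f \o shift t) (h *: 1) - f t) @[h --> 0^'] --> D.
  apply/cvgrPdist_le => e e0.
  have C0 : 0 < `|C| + 1 by rewrite ltr_wpDl.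
  near=> h; have h0 : h != 0 by near: h; exact: nbhs_dnbhs_neq.
  have h1 : `|h| <= 1 /\ `|h| <= e / (`|C| + 1).
    split; near: h; apply: dnbhs0_le => //; exact: divr_gt0.
  case: h1 => h1 h2.
  rewrite /= [h *: 1]mulr1 -[D in D - _](scalerK h0) -scalerBr normrZ distrC.
  rewrite [h + t]addrC normfV ler_pdivrMl ?normr_gt0//.
  rewrite (le_trans (fC h h1))// -real_normK ?num_real// -mulrA.
  rewrite ler_wpM2l// (@le_trans _ _ (`|h| * (`|C| + 1)))//.
    by rewrite ler_wpM2l// (le_trans (ler_norm _))// lerDl.
  by rewrite -ler_pdivlMr.
by apply: DeriveDef; [apply/cvg_ex; exists D|apply: cvg_lim].
Unshelve. all: by end_near. Qed.

Lemma expsum_is_derive E (x : E^nat) (c L t : R) : complete_space E ->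
  0 <= c -> 0 <= L -> exp_bounded c L x ->
  is_derive t 1 (expsum x) (expsum (fun n => x n.+1) t).
Proof.
move=> cE c0 L0 xc.
apply: (is_derive_taylor (C := c * expR (2 * (2 + `|t|) * L))) => s s1.
apply: le_trans (expsum_taylor cE t s xc) _.
rewrite -mulrA ler_wpM2l ?sqr_ge0// ler_wpM2l// ler_expR ler_wpM2r//.
by rewrite ler_wpM2l//; move: s1; lra.
Qed.

Lemma expsum_map E F (f : {linear E -> F}) (x : E^nat) (c L t : R) :
  complete_space E -> continuous f -> exp_bounded c L x ->
  f (expsum x t) = expsum (f \o x) t.
Proof.
move=> cE cf xc; apply/esym/cvg_lim => //.
rewrite (_ : series _ = f \o series (fun n => (t ^+ n / n`!%:R) *: x n)).
  have h := expsum_cvg cE (t := t) xc.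
  exact: (cvg_comp _ _ h (cf (expsum x t))).
apply/funext => n; rewrite /series /= raddf_sum.
by apply: eq_bigr => i _; rewrite /= linearZ.
Qed.

(** On a ball, the tails of the series are uniformly small, and each partial
    sum maps the ball into a finite sum of totally bounded sets. *)
Lemma totally_bounded_expsum E F (B : nat -> E -> F) (L rho t : R) :
  complete_space F -> 0 <= rho ->
  (forall u, exp_bounded `|u| L (B ^~ u)) ->
  (forall n, totally_bounded (B n @` [set u | `|u| <= rho])) ->
  totally_bounded ((fun u => expsum (B ^~ u) t) @` [set u | `|u| <= rho]).
Proof.
move=> cF rho0 BL tB; apply: totally_bounded_approx => e e0.
have rho1 : 0 < rho + 1 by rewrite ltr_wpDl.
have /cvgrPdist_le/(_ _ (divr_gt0 e0 rho1)) :
    series (exp_coeff (`|t| * L)) @ \oo --> expR (`|t| * L).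
  exact: is_cvg_series_exp_coeff.
move=> [N _ /(_ N (leqnn N))] /= hN.
exists ((fun u => series (fun n => (t ^+ n / n`!%:R) *: B n u) N) @`
  [set u | `|u| <= rho]); last first.
  move=> _ [u urho <-]; exists (series (fun n => (t ^+ n / n`!%:R) *: B n u) N).
    by exists u.
  rewrite distrC (le_trans (expsum_tail cF t N (BL u)))//.
  apply: (@le_trans _ _ ((rho + 1) * (e / (rho + 1)))).
    rewrite (@le_trans _ _ (`|u| * (e / (rho + 1))))//.
      by rewrite ler_wpM2l// (le_trans (ler_norm _)).
    by rewrite ler_wpM2r ?divr_ge0 ?(ltW e0) ?(ltW rho1)// (le_trans urho)// lerDl.
  by rewrite mulrC divfK// gt_eqF.
elim: N {hN} => [|N IH].
  move=> r r0; exists [:: 0] => _ [u _ <-]; exists 0; first by rewrite inE.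
  by rewrite /series /= big_geq// subr0 normr0.
apply: totally_boundedD IH (totally_bounded_image
  (f := *:%R (t ^+ N / N`!%:R)) (k := `|t ^+ N / N`!%:R|) _ (tB N)).
  move=> _ [u urho <-].
  exists (series (fun n => (t ^+ n / n`!%:R) *: B n u) N),
         ((t ^+ N / N`!%:R) *: B N u); split.
  - by exists u.
  - by exists (B N u) => //; exists u.
  - by rewrite /series /= big_nat_recr.
by move=> u; rewrite normrZ.
Qed.

End ExpSum.

(** * Bounded operators *)

Section BoundedOperators.
Context (R : realType).
Implicit Types E F : normedModType R.

Lemma continuous_bounded E F (f : {linear E -> F}) : continuous f ->
  exists2 k, 0 <= k & forall u, `|f u| <= k * `|u|.
Proof.
move=> /linear_bounded_continuous/linear_boundedP/pinfty_ex_gt0[k k0 fk].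
by exists k => //; exact: ltW.
Qed.

Lemma bounded_op_continuous E F (f : {linear E -> F}) k :
  (forall u, `|f u| <= k * `|u|) -> continuous f.
Proof.
move=> fk; apply/linear_bounded_continuous/linear_boundedP.
near=> r => u; apply: (le_trans (fk u)); exact: ler_wpM2r.
Unshelve. all: by end_near. Qed.

Definition linear_of E F (f : E -> F) (lf : linear f) : {linear E -> F} :=
  HB.pack f (GRing.isLinear.Build _ _ _ _ _ lf).

Lemma iter_exp_bounded E (A : {linear E -> E}) L u : 0 <= L ->
  (forall u, `|A u| <= L * `|u|) -> exp_bounded `|u| L (fun n => iter n A u).
Proof.
move=> L0 AL; elim=> [|n IH]; first by rewrite expr0 mulr1.
rewrite iterS (le_trans (AL _))// exprS mulrCA ler_wpM2l//.
Qed.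

Lemma unit_ball_bound E F (f : {linear E -> F}) (C : R) :
  (forall u, `|u| <= 1 -> `|f u| <= C) -> forall u, `|f u| <= C * `|u|.
Proof.
move=> fC u; have [->|u0] := eqVneq u 0; first by rewrite linear0 !normr0 mulr0.
rewrite -ler_pdivrMr ?normr_gt0// mulrC -[_^-1]ger0_norm ?invr_ge0//.
rewrite -normrZ -linearZ; apply: fC.
by rewrite normrZ ger0_norm ?invr_ge0// mulVf// normr_eq0.
Qed.

End BoundedOperators.

(** * Growth of solutions and uniqueness *)

Section Energy.
Context (R : realType) (E : normedModType R).

Lemma is_derive_quotient (f : R -> E) (t : R) (D : E) : is_derive t 1 f D ->
  h^-1 *: ((f \o shift t) (h *: 1) - f t) @[h --> 0^'] --> D.
Proof. by case=> cf <-. Qed.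

(** Let [s] maximize [e^(- w' x) |v x|] on [[0, t]]. If [s > 0] then
    [|v (s - r)| <= e^(- w' r) |v s|] for small [r], whereas the hypothesis
    gives [|v (s - r)| >= (1 - r w) |v s| - o(r)]; as [w < w'] this is
    impossible unless the maximum is at most [|v 0|]. *)
Lemma growth_bound (v D : R -> E) (w w' : R) : w < w' ->
  {within `[0, +oo[, continuous v} ->
  (forall t : R, 0 < t -> is_derive t 1 v (D t)) ->
  (forall t r : R, 0 < t -> 0 < r ->
    (1 - r * w) * `|v t| <= `|v t - r *: D t|) ->
  forall t : R, 0 <= t -> `|v t| <= expR (w' * t) * `|v 0|.
Proof.
move=> ww' cv dv disp t t0.
pose phi x := expR (- (w' * x)) * `|v x|.
have cphi : {within `[0, t], continuous phi}.
  move=> x; apply: cvgM.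
    apply: (continuous_subspaceT (f := fun y => expR (- (w' * y)))) => y.
    apply: continuous_comp; last exact: continuous_expR.
    by apply: cvgN; apply: cvgMr; exact: cvg_id.
  apply: continuous_comp; last exact: norm_continuous.
  apply: continuous_subspaceW cv x.
  by move=> y /=; rewrite !in_itv /= andbT => /andP[].
have [s] := EVT_max t0 cphi; rewrite in_itv /= => /andP[s0 st] smax.
suff phis : phi s <= `|v 0|.
  rewrite mulrC -ler_pdivrMr ?expR_gt0// -expRN mulrC.
  by apply: le_trans phis; apply: smax; rewrite in_itv /= t0 lexx.
move: s0; rewrite le_eqVlt => /predU1P[<-|s0].
  by rewrite /phi mulr0 oppr0 expR0 mul1r.
rewrite leNgt; apply/negP => phis.
have V0 : 0 < `|v s|.
  have : 0 < phi s by apply: le_lt_trans phis.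
  by rewrite /phi pmulr_rgt0// expR_gt0.
have d0 : 0 < w' - w by rewrite subr_gt0.
pose eta := (w' - w) * `|v s| / 2.
have eta0 : 0 < eta by rewrite divr_gt0// mulr_gt0.
have /cvgrPdist_le/(_ _ eta0) := is_derive_quotient (dv s s0).
move=> /nbhs_ballP[d /= d1 hd].
pose m := (w + w') / 2.
(* The first two bounds make [s - r] admissible; the third gives
   [1 + w' r >= 0]; the last makes the second-order term in [r] smaller
   than the first-order one. *)
pose r := Num.min (Num.min (d / 2) s)
  (Num.min (`|w'| + 1)^-1 ((w' - w) / 4 / (`|m * w'| + 1))).
have r0 : 0 < r.
  rewrite !lt_min s0 !divr_gt0//= ?invr_gt0 ?ltr_wpDl//.
have [rd rs rw' rm] : [/\ r <= d / 2, r <= s, r <= (`|w'| + 1)^-1 &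
    r <= (w' - w) / 4 / (`|m * w'| + 1)].
  by rewrite !ge_min !lexx ?orbT.
clearbody r.
have vsr : `|v (s - r)| <= expR (- (w' * r)) * `|v s|.
  have : phi (s - r) <= phi s.
    by apply: smax; rewrite in_itv /=; move: r0 rs st; lra.
  rewrite /phi -ler_pdivlMl ?expR_gt0// -expRN mulrA -expRD.
  by congr (_ <= expR _ * _); ring.
have quot : `|v s - r *: D s - v (s - r)| <= r * eta.
  have rd' : ball 0 d (- r).
    by rewrite -ball_normE /= sub0r opprK gtr0_norm//; move: rd d1; lra.
  have := hd _ rd'; rewrite oppr_eq0 gt_eqF// => /(_ isT).
  rewrite [(- r)%:A]mulr1 [- r + s]addrC => H.
  have -> : v s - r *: D s - v (s - r) =
      - (r *: (D s - (- r)^-1 *: (v (s - r) - v s))).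
    rewrite scalerBr scalerA invrN mulrN divff ?gt_eqF// scaleN1r opprK.
    by rewrite opprD opprB addrA [- (r *: D s) + _]addrC.
  by rewrite normrN normrZ gtr0_norm// ler_pM2l.
have key : (1 - r * w) - r * (w' - w) / 2 <= expR (- (w' * r)).
  rewrite -(ler_pM2r V0) mulrBl.
  have := disp s r s0 r0.
  have := ler_distD (v (s - r)) (v s - r *: D s) 0; rewrite !subr0.
  have -> : r * (w' - w) / 2 * `|v s| = r * eta by rewrite /eta; ring.
  by move: quot vsr; lra.
(* [e^(- x) (1 + x) <= 1] replaces a Taylor expansion of the exponential. *)
have e1 : expR (- (w' * r)) * (1 + w' * r) <= 1.
  rewrite -[leRHS](expRxMexpNx_1 (w' * r)) mulrC ler_wpM2r ?expR_ge0//.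
  exact: expR_ge1Dx.
have w'r : 0 <= 1 + w' * r.
  have : `|w' * r| <= 1.
    rewrite normrM [`|r|]gtr0_norm//.
    rewrite -[leRHS](@mulVf _ (`|w'| + 1)) ?gt_eqF ?ltr_wpDl// mulrC.
    by apply: ler_pM => //; [exact: ltW|rewrite lerDl].
  by rewrite ler_norml => /andP[]; lra.
have e2 : (1 - r * m) * (1 + w' * r) <= 1.
  apply: le_trans e1; rewrite ler_wpM2r//; move: key; rewrite /m; lra.
have e3 : r * (w' - m) <= r * (r * (m * w')) by move: e2; lra.
have e4 : r * (m * w') <= (w' - w) / 4.
  rewrite (le_trans (ler_norm _))// normrM gtr0_norm//.
  rewrite (@le_trans _ _ (r * (`|m * w'| + 1)))//.
    by rewrite ler_pM2l// lerDl.
  by rewrite -ler_pdivlMr// ltr_wpDl.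
move: e3; rewrite ler_pM2l//; move: e4 d0; rewrite /m; lra.
Qed.

(** The operator bound gives [|v - r A v| >= (1 - r L) |v|], so that the growth
    estimate applies to the difference of two solutions, which starts from
    [0]. *)
Lemma ode_unique (A : {linear E -> E}) (L : R) (v1 v2 : R -> E) :
  0 <= L -> (forall u, `|A u| <= L * `|u|) ->
  solves A (v1 0) v1 -> solves A (v1 0) v2 -> forall t, 0 <= t -> v1 t = v2 t.
Proof.
move=> L0 AL [c1 _ d1] [c2 v20 d2] t t0.
have : `|(v1 \- v2) t| <= expR ((L + 1) * t) * `|(v1 \- v2) 0|.
  apply: (@growth_bound _ (fun t => A (v1 t) - A (v2 t)) L) => //.
  - by rewrite ltrDl.
  - by move=> x; apply: cvgB; [exact: c1|exact: c2].
  - by move=> s s0; apply: is_deriveB; [exact: d1|exact: d2].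
  - move=> s r s0 r0; rewrite -linearB mulrBl mul1r -mulrA.
    rewrite (le_trans _ (lerB_dist _ _))// lerB// normrZ gtr0_norm//.
    by rewrite ler_pM2l.
by rewrite /= v20 subrr normr0 mulr0 normr_le0 subr_eq0 => /eqP.
Qed.

End Energy.

(** * The exponential group of a bounded operator *)

Section ExpGroup.
Context (R : realType) (E : normedModType R) (cE : complete_space E).
Context (A : {linear E -> E}) (L : R).
Hypotheses (L0 : 0 <= L) (AL : forall u, `|A u| <= L * `|u|).

Let itA u := iter_exp_bounded u L0 AL.

Lemma exp_group0 u : exp_group A 0 u = u.
Proof. exact: expsum0. Qed.

Lemma exp_group_linear t : linear (exp_group A t).
Proof.
move=> a u v; rewrite -(expsumP cE a t (c := `|u| + `|v|) (L := L)).
- congr expsum; apply/funext => n; elim: n => //= n ->.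
  by rewrite linearP.
- by move=> n; rewrite (le_trans (itA u n))// ler_wpM2r ?exprn_ge0// lerDl.
- by move=> n; rewrite (le_trans (itA v n))// ler_wpM2r ?exprn_ge0// lerDr.
Qed.

Lemma exp_group_norm t u : `|exp_group A t u| <= expR (`|t| * L) * `|u|.
Proof.
by rewrite [_ * `|u|]mulrC; apply: expsum_norm; [exact: cE|exact: itA].
Qed.

Lemma exp_group_is_derive u (t : R) :
  is_derive t 1 (exp_group A ^~ u) (A (exp_group A t u)).
Proof.
have cA : continuous A := bounded_op_continuous AL.
rewrite (expsum_map t cE cA (itA u)).
exact: expsum_is_derive (itA u).
Qed.

Lemma exp_group_solves u : solves A u (exp_group A ^~ u).
Proof.
split; [|exact: exp_group0|by move=> t _; exact: exp_group_is_derive].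
apply: continuous_subspaceT => t.
have [/derivable1_diffP] := exp_group_is_derive u t.
by move=> /differentiable_continuous.
Qed.

Lemma solves_exp_group u0 u :
  solves A u0 u <-> (forall t, 0 <= t -> u t = exp_group A t u0).
Proof.
have sS := exp_group_solves u0; split=> [su|uS].
  have u00 : u 0 = u0 by case: su.
  by apply: ode_unique L0 AL _ _; rewrite u00.
split; last 1 first.
- move=> t t0; rewrite uS ?ltW//.
  apply: near_eq_is_derive (exp_group_is_derive u0 t).
  near=> s; rewrite uS// ltW//; near: s; exact: lt_nbhsr.
- apply: (@subspace_eq_continuous _ _ _ (exp_group A ^~ u0 : subspace _ -> _)).
    by move=> t /set_mem; rewrite /= in_itv /= andbT => /uS.
  by have [] := exp_group_solves u0.
- by rewrite uS// exp_group0.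
Unshelve. all: by end_near. Qed.

(** As functions of [t], both sides solve the same equation with the same
    initial value. *)
Lemma exp_groupD t s u : 0 <= t ->
  exp_group A (t + s) u = exp_group A t (exp_group A s u).
Proof.
move=> t0; pose v r := exp_group A (r + s) u.
have v0 : v 0 = exp_group A s u by rewrite /v add0r.
rewrite -v0; move: t t0; apply: (ode_unique (v1 := v) L0 AL); last first.
  exact: exp_group_solves.
have dv (r : R) : is_derive r 1 v (A (v r)).
  have [d1 d2] := exp_group_is_derive u (r + s).
  have e : (fun h => h^-1 *: ((v \o shift r) (h *: 1) - v r)) =
    (fun h => h^-1 *: ((exp_group A ^~ u \o shift (r + s)) (h *: 1) -
                       exp_group A (r + s) u)).
    by apply/funext => h; rewrite /v /= addrA.
  by split; rewrite /derivable /derive e.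
split => //.
apply: continuous_subspaceT => t.
have [/derivable1_diffP] := dv t.
by move=> /differentiable_continuous.
Qed.

End ExpGroup.

(** * Splitting of the group *)

Section Perturbation.
Context (R : realType) (E X : normedModType R).
Hypotheses (cE : complete_space E) (cX : complete_space X).
Variables (A N : {linear E -> E}) (NX : {linear X -> X}).
Variables (K : {linear E -> X}) (iota : {linear X -> E}).
Hypotheses (cN : continuous N) (cNX : continuous NX) (cK : continuous K)
  (ci : continuous iota).
Hypothesis iotaN : forall v, iota (NX v) = N (iota v).
Hypothesis AE : forall u, A u = iota (K u) + N u.

(** The coefficients of the compact part: [iter n A = iter n N + iota B_n]
    where [B_n] takes its values in [X], not only in [E]. *)
Fixpoint pert_coef (n : nat) (u : E) : X :=
  if n is m.+1 then K (iter m A u) + NX (pert_coef m u) else 0.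

Lemma iter_pert n u : iter n A u = iter n N u + iota (pert_coef n u).
Proof.
elim: n => [|n IH] /=; first by rewrite linear0 addr0.
by rewrite AE linearD iotaN [in N _]IH linearD addrCA.
Qed.

(** A single constant for all the operators, so that the three exponential
    series are dominated by the same scalar one. *)
Lemma perturbation_bounds : exists2 L : R, 0 <= L &
  [/\ forall u, `|A u| <= L * `|u|, forall u, `|N u| <= L * `|u| &
      forall u, exp_bounded `|u| L (pert_coef ^~ u)].
Proof.
have [k k0 Kk] := continuous_bounded cK.
have [n n0 Nn] := continuous_bounded cN.
have [x x0 Xx] := continuous_bounded cNX.
have [i i0 ii] := continuous_bounded ci.
(* [i * k + n] bounds [A], and [k + x] is the factor in the recursion for
   [pert_coef]. *)
pose L := i * k + n + x + k.
have ik0 : 0 <= i * k by rewrite mulr_ge0.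
have L0 : 0 <= L by rewrite !addr_ge0.
have AL u : `|A u| <= L * `|u|.
  rewrite AE (le_trans (ler_normD _ _))//.
  have u0 : 0 <= `|u| by [].
  have : `|iota (K u)| <= i * k * `|u|.
    by rewrite (le_trans (ii _))// -mulrA ler_wpM2l.
  have := Nn u; have := mulr_ge0 x0 u0; have := mulr_ge0 k0 u0; rewrite /L; lra.
exists L => //; split => // u.
  by rewrite (le_trans (Nn u))// ler_wpM2r// /L; move: ik0 x0 k0; lra.
elim=> [|m IH] /=; first by rewrite normr0 expr0 mulr1.
rewrite (le_trans (ler_normD _ _))//.
have h1 : `|K (iter m A u)| <= k * (`|u| * L ^+ m).
  by rewrite (le_trans (Kk _))// ler_wpM2l// iter_exp_bounded.
have h2 : `|NX (pert_coef m u)| <= x * (`|u| * L ^+ m).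
  by rewrite (le_trans (Xx _))// ler_wpM2l.
have z0 : 0 <= `|u| * L ^+ m by rewrite mulr_ge0// exprn_ge0.
have : (k + x) * (`|u| * L ^+ m) <= L * (`|u| * L ^+ m).
  by rewrite ler_wpM2r// /L; move: ik0 n0; lra.
rewrite mulrDl exprS mulrCA; lra.
Qed.

Definition pert_exp t u : X := expsum (pert_coef ^~ u) t.

Lemma exp_group_pert t u :
  exp_group A t u = exp_group N t u + iota (pert_exp t u).
Proof.
have [L L0 [AL NL BL]] := perturbation_bounds.
have [i i0 ii] := continuous_bounded ci.
rewrite /pert_exp (expsum_map t cX ci (BL u)).
have e : (fun n => iter n A u) =
    (fun n => 1 *: (fun n => iter n N u) n + (iota \o (pert_coef ^~ u)) n).
  by apply/funext => n; rewrite scale1r iter_pert.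
rewrite [LHS](_ : _ = expsum (fun n => iter n A u) t)// e.
rewrite (expsumP cE 1 t (c := (1 + i) * `|u|) (L := L)) ?scale1r//.
  move=> n; rewrite (le_trans (iter_exp_bounded u L0 NL n))// -mulrA.
  rewrite ler_peMl ?lerDl//.
  by rewrite mulr_ge0 ?exprn_ge0.
move=> n; rewrite /= (le_trans (ii _))// -mulrA.
rewrite (@le_trans _ _ (i * (`|u| * L ^+ n)))//.
  by apply: ler_wpM2l => //; exact: BL.
by rewrite ler_wpM2r ?mulr_ge0 ?exprn_ge0// lerDr.
Qed.

Lemma pert_coef_linear n : linear (pert_coef n).
Proof.
have itlin m : linear (iter m A).
  by elim: m => // m IH a u v; rewrite !iterS IH linearP.
elim: n => [|n IH] a u v /=; first by rewrite scaler0 addr0.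
by rewrite itlin IH !linearP scalerDr addrACA.
Qed.

Lemma pert_exp_linear t : linear (pert_exp t).
Proof.
have [L L0 [AL NL BL]] := perturbation_bounds.
move=> a u v; rewrite -(expsumP cX a t (c := `|u| + `|v|) (L := L)).
- by congr expsum; apply/funext => n; rewrite pert_coef_linear.
- by move=> n; rewrite (le_trans (BL u n))// ler_wpM2r ?exprn_ge0// lerDl.
- by move=> n; rewrite (le_trans (BL v n))// ler_wpM2r ?exprn_ge0// lerDr.
Qed.

Lemma pert_exp_bounded t : exists k, forall u, `|pert_exp t u| <= k * `|u|.
Proof.
have [L L0 [AL NL BL]] := perturbation_bounds.
exists (expR (`|t| * L)) => u; rewrite [_ * `|u|]mulrC.
by apply: expsum_norm; [exact: cX|exact: BL].
Qed.

(** In the recursion, [K] composed with [iter n A] is compact because [K] is,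
    and [NX] maps totally bounded sets to totally bounded sets. *)
Lemma pert_exp_compact t : compact_operator K -> compact_operator (pert_exp t).
Proof.
move=> /(compact_operatorP _ cX) tK; apply/(compact_operatorP _ cX) => rho.
have [rho0|rho0] := leP 0 rho; last first.
  move=> e _; exists [::] => a [u /= urho _].
  by have := le_lt_trans urho rho0; rewrite ltNge normr_ge0.
have [L L0 [AL NL BL]] := perturbation_bounds.
have [x x0 Xx] := continuous_bounded cNX.
apply: (totally_bounded_expsum t cX rho0 BL) => n.
elim: n => [|n IH].
  move=> e e0; exists [:: 0] => _ [u _ <-]; exists 0; first by rewrite inE.
  by rewrite /= subr0 normr0.
apply: totally_boundedD (tK (rho * L ^+ n)) (totally_bounded_image Xx IH).
move=> _ [u /= urho <-]; exists (K (iter n A u)), (NX (pert_coef n u)); split => //.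
  exists (iter n A u) => //=; rewrite (le_trans (iter_exp_bounded u L0 AL n))//.
  by rewrite ler_wpM2r// exprn_ge0.
by exists (pert_coef n u) => //; exists u.
Qed.

End Perturbation.

(** * Exponential decay of the dissipative part *)

Section Decay.
Context (R : realType) (E : normedModType R) (cE : complete_space E).

(** Half of the rate [alpha] is given up because the growth estimate asks for a
    strict inequality between the two rates. *)
Lemma dissipative_decay (N : {linear E -> E}) (alpha : R) : continuous N ->
  0 < alpha ->
  (forall r u, 0 < r -> (1 + r * alpha) * `|u| <= `|u - r *: N u|) ->
  forall t u, 0 <= t -> `|exp_group N t u| <= expR (- (alpha / 2 * t)) * `|u|.
Proof.
move=> /continuous_bounded[L L0 NL] a0 dN t u t0.
have [c0 u0 du] := exp_group_solves cE L0 NL u.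
have := @growth_bound _ _ _ _ (- alpha) (- (alpha / 2)) _ c0 du _ t t0.
rewrite mulNr u0; apply; first by move: a0; lra.
by move=> s r s0 r0; rewrite mulrN opprK; exact: dN.
Qed.

End Decay.

(** * Limit sets of eventually almost compact semigroups *)

Section AsymptoticSmoothness.
Context (R : realType) (E : normedModType R) (cE : complete_space E).
Variable S : R -> E -> E.
Hypothesis SD : forall t s u, 0 <= t -> 0 <= s -> S (t + s) u = S t (S s u).
Hypothesis S0 : forall u, S 0 u = u.
Hypothesis Snet : forall rho e, 0 < e ->
  exists2 t, 0 <= t & finite_net e (S t @` [set u | `|u| <= rho]).

Variable B : set E.
Hypotheses (B0 : B !=set0) (clB : closed B) (bB : bounded_set B).
Hypothesis SB : forall t, 0 <= t -> S t @` B `<=` B.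

(** The omega-limit set of [B]: since the sets [S t @` B] decrease, it is the
    intersection of their closures. *)
Definition omega_limit := \bigcap_(t in [set t | 0 <= t]) closure (S t @` B).

Lemma orbit_tail_sub t t' : 0 <= t -> t <= t' -> S t' @` B `<=` S t @` B.
Proof.
move=> t0 tt' _ [b Bb <-]; exists (S (t' - t) b).
  by apply: (SB (t := t' - t)); [rewrite subr_ge0|exists b].
by rewrite -SD ?subr_ge0// addrC subrK.
Qed.

(** Such an ultrafilter is Cauchy, because a late enough [S t @` B] has an
    [e]-net; its limit is in each of the closed sets that it contains. Both
    the compactness of the limit set and its attraction follow. *)
Lemma ultra_omega_limit (F : set_system E) : UltraFilter F ->
  (forall t, 0 <= t -> F (closure (S t @` B))) ->
  exists2 l, omega_limit l & F --> l.
Proof.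
move=> FU FS; have /bounded_setP[rho Brho] := bB.
have /cE/cvg_ex[l Fl] : cauchy F.
  apply/cauchyP => e e0; have e20 : 0 < e / 2 by rewrite divr_gt0.
  have [t t0 tnet] := Snet rho e20.
  apply: (ultra_finite_net FU (FS t t0)).
  rewrite [e]splitr; apply: finite_net_closure => //.
  by apply: finite_netS tnet => _ [b Bb <-]; exists b => //; exact: Brho.
exists l => // t t0.
rewrite (closure_id (closure _)).1; last exact: closed_closure.
by move=> V /Fl FV; exact: (filter_ex (filterI (FS t t0) FV)).
Qed.

Lemma compact_omega_limit : compact omega_limit.
Proof.
rewrite compact_ultra /= => F FU FC.
have [t t0|l Cl Fl] := @ultra_omega_limit F FU; last by exists l.
by apply: filterS FC => x; exact.
Qed.

Lemma omega_limit_sub : omega_limit `<=` B.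
Proof.
move=> x /(_ 0 (lexx _)); move=> h; apply: clB; apply: closureS h.
by move=> _ [b Bb <-]; rewrite S0.
Qed.

(** Otherwise the points of [S t @` B] at distance more than [e] from the limit
    set generate a proper filter; an ultrafilter above it converges to a point
    of the limit set, a contradiction. *)
Lemma omega_limit_near e : 0 < e ->
  exists2 t, 0 <= t &
    forall b, B b -> (edist_inf omega_limit (S t b) <= e%:E)%E.
Proof.
move=> e0; apply: contrapT => far.
pose P t := [set x | (S t @` B) x /\ ~ (edist_inf omega_limit x <= e%:E)%E].
have Pn t : 0 <= t -> P t !=set0.
  move=> t0; apply: contrapT => P0; apply: far; exists t => // b Bb.
  by apply: contrapT => nb; apply: P0; exists (S t b); split => //; exists b.
have FF : ProperFilter (filter_from [set t | 0 <= t] P).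
  apply: filter_from_proper; last by move=> t t0; exact: Pn.
  apply: filter_from_filter; first by exists 0 => /=.
  move=> t s t0 s0; exists (Num.max t s); first by rewrite /= le_max t0.
  move=> x [Sx nx]; split; split => //.
    by apply: orbit_tail_sub Sx => //; rewrite le_max lexx.
  by apply: orbit_tail_sub Sx => //; rewrite le_max lexx orbT.
have [G [GU FG]] := ultraFilterLemma FF.
have GP t : 0 <= t -> G (P t) by move=> t0; apply: FG; exists t.
have [t t0|l Cl Gl] := ultra_omega_limit GU.
  by apply: filterS (GP t t0) => x [Sx _]; exact: subset_closure.
have Gb := Gl _ (nbhsx_ballx l e e0).
have [x [[_ nx] lx]] := filter_ex (filterI (GP 0 (lexx _)) Gb).
apply: nx; rewrite (@le_trans _ _ (edist (x, l)))//.
  by apply: ereal_inf_lbound; exists l.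
by apply: edist_fin => //; exact: ball_sym.
Qed.

Lemma omega_limit_attracts : attracts S omega_limit B.
Proof.
have small e : 0 < e -> \forall t \near +oo,
    (0 <= ereal_sup [set edist_inf omega_limit (S t b) | b in B] <= e%:E)%E.
  move=> e0; have [t t0 tC] := omega_limit_near e0.
  near=> s; have ts : t <= s.
    by near: s; apply: nbhs_pinfty_ge; exact: num_real.
  apply/andP; split.
    have [b Bb] := B0; apply: (@le_trans _ _ (edist_inf omega_limit (S s b))).
      exact: edist_inf_ge0.
    by apply: ereal_sup_ubound; exists b.
  apply: ge_ereal_sup => _ [b Bb <-].
  have [|b' Bb' <-] := @orbit_tail_sub t s t0 ts (S s b); first by exists b.
  exact: tC.
apply/fine_cvgP; split.
  apply: filterS (small 1 ltr01) => t /andP[h0 h1].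
  by rewrite ge0_fin_numE// (le_lt_trans h1)// ltry.
apply/cvgrPdist_le => e e0; apply: filterS (small e e0) => t /andP[h0 h1].
rewrite sub0r normrN /= ger0_norm ?fine_ge0// -lee_fin fineK//.
by rewrite ge0_fin_numE// (le_lt_trans h1)// ltry.
Unshelve. all: by end_near. Qed.

End AsymptoticSmoothness.

(** * Compact perturbations of dissipative operators *)

Section CompactPerturbation.
Context (R : realType) (E X : normedModType R).
Hypotheses (cE : complete_space E) (cX : complete_space X).
Variables (N : {linear E -> E}) (NX : {linear X -> X}).
Variables (K : {linear E -> X}) (iota : {linear X -> E}) (alpha : R).
Hypotheses (cN : continuous N) (cNX : continuous NX) (cK : continuous K)
  (ci : continuous iota).
Hypothesis iotaN : forall v, iota (NX v) = N (iota v).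
Hypothesis kK : compact_operator K.
Hypothesis a0 : 0 < alpha.
Hypothesis dissN :
  forall r u, 0 < r -> (1 + r * alpha) * `|u| <= `|u - r *: N u|.

Variable A : E -> E.
Hypothesis AE : forall u, A u = iota (K u) + N u.

(** The abstract form of the result: [A] is the sum of an operator [N] that
    generates exponential decay and of an operator that factors through a
    compact one, [K], and [N] lifts to an operator [NX] on the intermediate
    space. *)
Theorem compact_perturbation :
  [/\ forall u0 u, solves A u0 u <->
        (forall t, 0 <= t -> u t = exp_group A t u0),
      exists (S1 : R -> {linear E -> E}) (S2 : R -> {linear E -> X}),
        [/\ forall t u0, 0 <= t ->
              exp_group A t u0 = S1 t u0 + iota (S2 t u0),
            forall t, 0 < t -> continuous (S1 t),
            exists M omega : R, 0 < omega /\
              (forall t, 0 < t ->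
                (op_norm (S1 t) <= (M * expR (- (omega * t)))%:E)%E) &
            forall t, 0 < t -> continuous (S2 t) /\ compact_operator (S2 t)]
    & asymptotically_smooth (exp_group A)].
Proof.
have lA : linear A.
  by move=> a u v; rewrite !AE !linearP scalerDr addrACA.
pose A' := linear_of lA; rewrite -[A]/(A' : E -> E).
have A'E u : A' u = iota (K u) + N u := AE u.
have [L L0 [AL NL BL]] := perturbation_bounds cN cNX cK ci A'E.
have decay := dissipative_decay cE cN a0 dissN.
have split := exp_group_pert cE cX cN cNX cK ci iotaN A'E.
have S2c t := pert_exp_compact cX cN cNX cK ci A'E t kK.
split; first by move=> u0 u; exact: (solves_exp_group cE L0 AL u0 u).
- exists (fun t => linear_of (exp_group_linear cE L0 NL t)).
  exists (fun t => linear_of (pert_exp_linear cX cN cNX cK ci A'E t)).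
  split.
  + by move=> t u0 t0; exact: split.
  + move=> t t0; apply: (bounded_op_continuous (k := expR (`|t| * L))) => u.
    exact: (exp_group_norm cE L0 NL).
  + exists 1, (alpha / 2); split; first by rewrite divr_gt0.
    move=> t t0; rewrite mul1r; apply: ge_ereal_sup => _ [u /= u1 <-].
    rewrite lee_fin (le_trans (decay t u (ltW t0)))//.
    by rewrite ler_piMr// expR_ge0.
  + move=> t t0; split; last exact: S2c.
    have [k kS] := pert_exp_bounded cX cN cNX cK ci A'E t.
    by apply: (bounded_op_continuous (k := k)) => u; exact: kS.
- move=> B B0 clB bB SB.
  have SD t s u : 0 <= t -> 0 <= s ->
      exp_group A' (t + s) u = exp_group A' t (exp_group A' s u).
    by move=> t0 _; exact: (exp_groupD cE L0 AL).
  have S0 u := exp_group0 A' u.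
  have Snet rho e : 0 < e -> exists2 t, 0 <= t &
      finite_net e (exp_group A' t @` [set u | `|u| <= rho]).
    move=> e0; pose x := (`|rho| + 1) * (e / 2)^-1.
    have e20 : 0 < e / 2 by rewrite divr_gt0.
    have x0 : 0 < x by rewrite mulr_gt0 ?invr_gt0// ltr_wpDl.
    (* [x e^(- x) <= 1] makes the [S_1] part of the image at most [e / 2]. *)
    exists (x / (alpha / 2)); first by rewrite ltW// !divr_gt0.
    set t := x / (alpha / 2).
    have [i i0 ii] := continuous_bounded ci.
    have := S2c t => /(compact_operatorP _ cX)/(_ rho) tS2.
    have [s ss] := totally_bounded_image ii tS2 e20.
    exists s => _ [u /= urho <-].
    have [|c cs cu] := ss (iota (pert_exp A' NX K t u)).
      by exists (pert_exp A' NX K t u) => //; exists u.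
    exists c => //; rewrite split opprD addrA addrAC.
    rewrite (le_lt_trans (ler_normB _ _))// [e]splitr ltr_leD//.
    have tE : alpha / 2 * t = x by rewrite /t mulrC divfK// gt_eqF// divr_gt0.
    rewrite (le_trans (decay t u _)) ?tE//; first by rewrite /t ltW// !divr_gt0.
    have ex : expR (- x) * x <= 1.
      rewrite expRN ler_pdivrMl ?expR_gt0// mulr1.
      by rewrite (le_trans _ (expR_ge1Dx x))// lerDr.
    rewrite (@le_trans _ _ (expR (- x) * (`|rho| + 1)))//.
      rewrite ler_wpM2l ?expR_ge0// (le_trans urho)// (le_trans (ler_norm _))//.
      by rewrite lerDl.
    have -> : `|rho| + 1 = x * (e / 2) by rewrite /x divfK// gt_eqF.
    by rewrite mulrA ler_piMl// ltW.
  exists (omega_limit (exp_group A') B); split.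
  + exact: (compact_omega_limit cE Snet bB).
  + exact: (omega_limit_sub S0 clB).
  + exact: (omega_limit_attracts cE SD Snet B0 bB SB).
Qed.

End CompactPerturbation.

(** * Monotonicity and lower semicontinuity of Lebesgue norms *)

Section Lnorm.
Context d (T : measurableType d) (R : realType).
Variable mu : {measure set T -> \bar R}.
Implicit Types (f g : T -> R) (p : \bar R).
Local Notation "''N_' p [ F ]" := ('N[mu]_p[EFin \o F])%E.

Lemma measurable_norm_powR f (r : R) : measurable_fun setT f ->
  measurable_fun setT (fun x => (`|(EFin \o f) x| `^ r)%E).
Proof.
move=> mf; apply: (measurableT_comp (measurable_poweR _)).
by apply: measurableT_comp => //; exact/measurable_EFinP.
Qed.

Lemma poweR_le (x y : \bar R) (r : R) : 0 <= r -> (0 <= x)%E -> (x <= y)%E ->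
  (x `^ r <= y `^ r)%E.
Proof.
move=> r0 x0 xy; apply: gt0_ler_poweR => //; rewrite in_itv /= leey andbT//.
exact: le_trans xy.
Qed.

Lemma le_Lnorm f g p : (1 <= p)%E ->
  measurable_fun setT f -> measurable_fun setT g ->
  {ae mu, forall x, `|f x| <= `|g x|} -> ('N_p[f] <= 'N_p[g])%E.
Proof.
move=> p1 mf mg fg; rewrite unlock /Lnorm.
case: p p1 => [r|_|//].
  rewrite lee_fin => r1; have r0 : 0 <= r by apply: le_trans r1.
  apply: poweR_le; rewrite ?invr_ge0//.
    by apply: integral_ge0 => x _; exact: poweR_ge0.
  apply: ae_ge0_le_integral => //.
  - by move=> x _; exact: poweR_ge0.
  - exact: measurable_norm_powR.
  - by move=> x _; exact: poweR_ge0.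
  - exact: measurable_norm_powR.
  - by apply: filterS fg => x fgx _; apply: poweR_le => //=; rewrite lee_fin.
case: ifPn => // mu0; apply: le_ess_sup.
by apply: filterS fg => x fgx /=; rewrite lee_fin.
Qed.

(** Stated at a positive point only; in its use below, the value at [0] is
    covered by nonnegativity. *)
Lemma powR_cvg (a r : R) : 0 < a -> x `^ r @[x --> a] --> a `^ r.
Proof.
move=> a0; have : derivable (@powR R ^~ r) a 1.
  by apply: derivable_powR; rewrite in_itv /= andbT.
by move=> /derivable1_diffP/differentiable_continuous.
Qed.

Lemma limn_einf_ge0 (u : (\bar R)^nat) : (forall n, 0 <= u n)%E ->
  (0 <= limn_einf u)%E.
Proof.
move=> u0; rewrite limn_einf_lim; apply: lime_ge; first exact: is_cvg_einfs.
by apply: nearW => n; apply: le_ereal_inf_tmp => _ [m _ <-].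
Qed.

(** For finite [p] this is Fatou's lemma for [|u n| ^ p]; for [p = +oo] the
    bounds [|u n| <= c] hold simultaneously almost everywhere, and pass to the
    pointwise limit. *)
Lemma Lnorm_fatou (u : nat -> T -> R) f p (c : R) : (1 <= p)%E -> 0 <= c ->
  (forall n, measurable_fun setT (u n)) -> measurable_fun setT f ->
  {ae mu, forall x, u ^~ x @ \oo --> f x} ->
  (forall n, 'N_p[u n] <= c%:E)%E -> ('N_p[f] <= c%:E)%E.
Proof.
move=> p1 c0 mu_ mf uf; rewrite unlock /Lnorm.
case: p p1 => [r|_|//].
  rewrite lee_fin => r1 uc; have r0 : 0 < r by apply: lt_le_trans r1.
  have intc n : (\int[mu]_x (`|(EFin \o u n) x| `^ r) <= (c `^ r)%:E)%E.
    have I0 : (0 <= \int[mu]_x (`|(EFin \o u n) x| `^ r))%E.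
      by apply: integral_ge0 => x _; exact: poweR_ge0.
    have := poweR_le (ltW r0) (poweR_ge0 _ _) (uc n).
    by rewrite -poweRrM mulVf ?gt_eqF// poweRe1.
  have -> : c%:E = ((c `^ r)%:E `^ r^-1)%E.
    by rewrite poweR_EFin -powRrM mulfV ?gt_eqF// powRr1.
  apply: poweR_le; first by rewrite invr_ge0 ltW.
    by apply: integral_ge0 => x _; exact: poweR_ge0.
  apply: (@le_trans _ _
    (\int[mu]_x limn_einf (fun n => (`|(EFin \o u n) x| `^ r)%E))%E).
    apply: ae_ge0_le_integral => //.
    - by move=> x _; exact: poweR_ge0.
    - exact: measurable_norm_powR.
    - move=> x _; apply: limn_einf_ge0 => n; exact: poweR_ge0.
    - apply: measurableT_comp => //; apply: measurable_fun_limn_esup => n.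
      by apply: measurableT_comp => //; exact: measurable_norm_powR.
    apply: filterS uf => x uf _.
    have [fx0|fx0] := eqVneq (f x) 0.
      rewrite /= fx0 normr0 powR0 ?gt_eqF//; apply: limn_einf_ge0 => n.
      by rewrite lee_fin powR_ge0.
    rewrite (cvg_limn_einf_sup (l := (`|f x| `^ r)%:E) _).1//.
    apply: cvg_EFin; first exact: nearW.
    have pc : y `^ r @[y --> `|f x|] --> `|f x| `^ r.
      by apply: powR_cvg; rewrite normr_gt0.
    exact: (cvg_comp _ _ (cvg_norm uf) pc).
  apply: le_trans (fatou _ _ _ _) _ => //.
  - by move=> n; exact: measurable_norm_powR.
  - by move=> n x _; exact: poweR_ge0.
  rewrite limn_einf_lim; apply: lime_le; first exact: is_cvg_einfs.
  apply: nearW => n; apply: le_trans (intc n).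
  by apply: ereal_inf_lbound; exists n => /=.
case: ifPn => // mu0 uc; apply/ess_supP.
have : \forall x \ae mu, forall n, `|u n x| <= c.
  apply: ae_foralln => n; have /ess_supP := uc n.
  by apply: filterS => x /=; rewrite lee_fin.
apply: filterS2 uf => x ux uc' /=; rewrite lee_fin.
have nux : `|u n x| @[n --> \oo] --> `|f x| by exact: cvg_norm.
rewrite -(cvg_lim _ nux)//.
by apply: limr_le; [exact: cvgP _ nux|exact: nearW].
Qed.

End Lnorm.

(** * Norms of classes and multiplication operators *)

Section Lspace.
Context d (T : measurableType d) (R : realType).
Variables (mu : {measure set T -> \bar R}) (p : \bar R) (p1 : (1 <= p)%E).
Implicit Types (f g : T -> R) (u v : LspaceType mu p1).
Local Notation "''N_' p [ F ]" := ('N[mu]_p[EFin \o F])%E.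
Local Notation Lclass := (Lclass mu p1).

Lemma LspaceN u : `|u|%:E = 'N_p[u].
Proof. exact: (finite_norm_fine (Lfun_Sub p1 (Lspace_Lfun u))). Qed.

Lemma Lfun_measurable f : f \in Lfun mu p -> measurable_fun setT f.
Proof. by move=> /sub_Lfun_mfun; rewrite inE. Qed.

Lemma LclassN f : f \in Lfun mu p -> `|Lclass f|%:E = 'N_p[f].
Proof.
move=> fp; rewrite LspaceN; apply: ae_eq_Lnorm => //.
- exact: Lspace_measurable.
- exact: Lfun_measurable.
- exact: LclassE.
Qed.

Lemma Lclass_linear (a : R) f g : f \in Lfun mu p -> g \in Lfun mu p ->
  Lclass (fun x => a * f x + g x) = a *: Lclass f + Lclass g.
Proof.
move=> fp gp; rewrite -[RHS]Lclass_id; apply: Lclass_ae.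
have h1 := LspaceDE (a *: Lclass f) (Lclass g).
have h2 := LspaceZE a (Lclass f); have h3 := LclassE p1 fp.
have h4 := LclassE p1 gp; apply: filterS2 (filterI h1 h2) (filterI h3 h4).
by move=> x [/(_ I) /= -> /(_ I) ->] [/(_ I) -> /(_ I) ->].
Qed.

(** Membership and norm bound at once, for the multiplication operators and for
    the inclusion of the bounded continuous functions. *)
Lemma Lfun_dominated f u (c : R) : measurable_fun setT f ->
  {ae mu, forall x, `|f x| <= c * `|u x|} ->
  f \in Lfun mu p /\ `|Lclass f| <= `|c| * `|u|.
Proof.
move=> mf fc; have h : ('N_p[f] <= (`|c| * `|u|)%:E)%E.
  rewrite -normrZ LspaceN; apply: le_Lnorm => //; first exact: Lspace_measurable.
  apply: filterS2 (LspaceZE c u) fc => x /(_ I) -> fx /=.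
  by rewrite (le_trans fx)// normrM ler_wpM2r// ler_norm.
have fp : f \in Lfun mu p.
  by apply/andP; split; rewrite inE//= /finite_norm (le_lt_trans h)// ltry.
by split => //; rewrite -lee_fin LclassN.
Qed.

End Lspace.

Section Multiplication.
Context d (R : realType) (T : metricMeasurableType d R).
Variables (mu : {measure set T -> \bar R}) (p : \bar R) (p1 : (1 <= p)%E).
Implicit Types u v : LspaceType mu p1.
Variables (h : T -> R) (c : R).
Hypotheses (mh : measurable_fun setT h) (hc : {ae mu, forall x, `|h x| <= c}).

Lemma mul_operator_dominated u :
  (fun x => h x * u x) \in Lfun mu p /\ `|mul_operator h u| <= `|c| * `|u|.
Proof.
apply: Lfun_dominated.
  by apply: measurable_funM => //; exact: Lspace_measurable.
by apply: filterS hc => x hx; rewrite normrM ler_wpM2r.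
Qed.

Lemma mul_operatorE u :
  (mul_operator h u : T -> R) = (fun x => h x * u x) %[ae mu].
Proof. by apply: LclassE; case: (mul_operator_dominated u). Qed.

Lemma mul_operator_linear : linear (mul_operator h : LspaceType mu p1 -> _).
Proof.
move=> a u v; have [up _] := mul_operator_dominated u.
have [vp _] := mul_operator_dominated v.
rewrite -(Lclass_linear p1 a up vp); apply: Lclass_ae.
apply: filterS2 (LspaceDE (a *: u) v) (LspaceZE a u) => x /(_ I) h1 /(_ I) h2 _.
by rewrite h1 /= h2; ring.
Qed.

(** Pointwise, [|u + r h u| = (1 + r h) |u| >= (1 + r alpha) |u|]. This is the
    only place where the lower bound on [h] enters. *)
Lemma mul_operator_expansive (alpha r : R) u :
  0 <= alpha -> (forall x, alpha <= h x) -> 0 <= r ->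
  (1 + r * alpha) * `|u| <= `|u + r *: mul_operator h u|.
Proof.
move=> a0 ah r0; have c0 : 0 <= 1 + r * alpha by rewrite addr_ge0// mulr_ge0.
rewrite -[X in X * _]ger0_norm// -normrZ -lee_fin !LspaceN.
apply: le_Lnorm => //; [exact: Lspace_measurable|exact: Lspace_measurable|].
have h1 := LspaceZE (1 + r * alpha) u.
have h2 := LspaceDE u (r *: mul_operator h u).
have h3 := LspaceZE r (mul_operator h u).
apply: filterS2 (filterI h1 h2) (filterI h3 (mul_operatorE u)).
move=> x [/(_ I) -> /(_ I) ->] [/(_ I) /= -> /(_ I) ->].
rewrite (_ : u x + _ = (1 + r * h x) * u x); last by ring.
rewrite !normrM ler_wpM2r// ger0_norm// ger0_norm.
  by rewrite lerD2l ler_wpM2l.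
by rewrite addr_ge0// mulr_ge0// (le_trans a0).
Qed.

End Multiplication.

(** * Inclusions between Lebesgue spaces *)

Section Inclusion.
Context d (T : measurableType d) (R : realType).
Variable mu : {measure set T -> \bar R}.
Hypothesis muT : (mu setT < +oo)%E.
Implicit Types (f g : T -> R).
Local Notation "''N_' p [ F ]" := ('N[mu]_p[EFin \o F])%E.

Let muTfin : mu setT \is a fin_num.
Proof. by rewrite ge0_fin_numE. Qed.

(** True also for the zero measure, where the norm is [0] by convention but
    every property holds almost everywhere. *)
Lemma ae_le_Lnormy f : {ae mu, forall x, (`|f x|%:E <= 'N_+oo[f])%E}.
Proof.
rewrite unlock /Lnorm; case: ifPn => [mu0|].
  exact: (ess_sup_ge mu (abse \o (EFin \o f))).
rewrite -leNgt => mu0; exists setT; split => //.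
by apply/eqP; rewrite eq_le mu0 measure_ge0.
Qed.

Lemma Lfuny_bounded f : f \in Lfun mu +oo ->
  exists c : R, {ae mu, forall x, `|f x| <= c}.
Proof.
move=> fy; have := ae_le_Lnormy f; rewrite -(LclassN (leey _) fy) => h.
by exists `|Lclass mu (leey _) f|; apply: filterS h => x; rewrite lee_fin.
Qed.

Lemma bounded_Lfun f (c : R) p : (1 <= p)%E -> measurable_fun setT f ->
  {ae mu, forall x, `|f x| <= c} -> f \in Lfun mu p.
Proof.
move=> p1 mf fc; apply: (@Lfun_subset _ _ _ _ p +oo%E) => //; rewrite ?leey//.
apply/andP; split; rewrite inE//= /finite_norm unlock /Lnorm.
case: ifPn => // mu0; apply: (@le_lt_trans _ _ c%:E); last exact: ltry.
by apply/ess_supP; apply: filterS fc => x; rewrite lee_fin.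
Qed.

(** For finite exponents, [a ^ p <= 1 + a ^ q] for [a >= 0]; integrating bounds
    the norm on the unit ball by a constant, and homogeneity does the rest in
    [Lspace_incl_bounded]. *)
Lemma Lnorm_unit_bound p q : (1 <= p)%E -> (1 <= q)%E -> (p <= q)%E ->
  exists2 C : R, 0 <= C &
    forall f, f \in Lfun mu q -> ('N_q[f] <= 1)%E -> ('N_p[f] <= C%:E)%E.
Proof.
move=> p1; case: q => [r|_ _|//]; last first.
  have c1 : (cst 1 : T -> R) \in Lfun mu p.
    by apply: (bounded_Lfun (c := 1)) => //; apply: aeW => x /=; rewrite normr1.
  exists `|Lclass mu p1 (cst 1)| => // f fy f1; rewrite LclassN//.
  apply: le_Lnorm => //; first exact: Lfun_measurable fy.
  apply: filterS (ae_le_Lnormy f) => x /le_trans/(_ f1).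
  by rewrite lee_fin normr1.
move=> r1 ; case: p p1 => [s|//|//] s1; rewrite lee_fin => sr.
rewrite lee_fin in r1; rewrite lee_fin in s1.
have r0 : 0 < r by exact: lt_le_trans r1.
have s0 : 0 < s by exact: lt_le_trans s1.
exists ((fine (mu setT) + 1) `^ s^-1); first exact: powR_ge0.
move=> f fq f1; have mf := Lfun_measurable fq.
have If1 : (\int[mu]_x (`|(EFin \o f) x| `^ r) <= 1)%E.
  have := poweR_le (ltW r0) (Lnorm_ge0 _ _ _) f1.
  by rewrite poweR_Lnorm ?gt_eqF// poweR_EFin powR1.
rewrite unlock /Lnorm -poweR_EFin; apply: poweR_le.
- by rewrite invr_ge0 ltW.
- by apply: integral_ge0 => x _; exact: poweR_ge0.
rewrite EFinD fineK//.
apply: (@le_trans _ _ (\int[mu]_x (1 + `|(EFin \o f) x| `^ r))%E).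
  apply: ge0_le_integral => //.
  - by move=> x _; exact: poweR_ge0.
  - exact: measurable_norm_powR.
  - by apply: emeasurable_funD => //; exact: measurable_norm_powR.
  - move=> x _ /=; rewrite -EFinD lee_fin.
    (* If [a <= 1] then [a ^ s <= 1]; otherwise [a ^ s <= a ^ r]. *)
    have [f1x|f1x] := leP `|f x| 1.
      rewrite (@le_trans _ _ 1)//; last by rewrite lerDl powR_ge0.
      have -> : 1 = 1 `^ s by rewrite powR1.
      by rewrite ge0_ler_powR ?nnegrE ?(ltW s0).
    rewrite (@le_trans _ _ (`|f x| `^ r))//; last by rewrite lerDr.
    by rewrite ler_powR// ltW.
rewrite ge0_integralD//=.
- by rewrite integral_cst// mul1e leeD.
- exact: (measurable_norm_powR r mf).
Qed.

Section Map.
Variables (p q : \bar R) (p1 : (1 <= p)%E) (q1 : (1 <= q)%E) (pq : (p <= q)%E).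

Lemma Lfun_incl (v : LspaceType mu q1) : (v : T -> R) \in Lfun mu p.
Proof. by apply: (Lfun_subset p1 q1 muTfin pq); exact: Lspace_Lfun. Qed.

Lemma Lspace_incl_linear : linear (fun v : LspaceType mu q1 => Lclass mu p1 v).
Proof.
move=> a u v; rewrite -(Lclass_linear p1 a (Lfun_incl u) (Lfun_incl v)).
apply: Lclass_ae.
apply: filterS2 (LspaceDE (a *: u) v) (LspaceZE a u) => x /(_ I) h1 /(_ I) h2 _.
by rewrite h1 /= h2.
Qed.

Lemma Lspace_incl_bounded : exists2 C : R, 0 <= C &
  forall v : LspaceType mu q1, `|Lclass mu p1 v| <= C * `|v|.
Proof.
have [C C0 hC] := Lnorm_unit_bound p1 q1 pq; exists C => //.
apply: (@unit_ball_bound _ _ _ (linear_of Lspace_incl_linear)) => v v1.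
rewrite -lee_fin LclassN; last exact: Lfun_incl.
by apply: hC; [exact: Lspace_Lfun|rewrite -LspaceN lee_fin].
Qed.

End Map.
End Inclusion.

(** * Completeness of Lebesgue spaces *)

Lemma nondecreasing_normed_series (R : realType) (E : normedModType R)
  (x : E^nat) : nondecreasing_seq [normed series x].
Proof. by apply: nondecreasing_series => k _ _; exact: normr_ge0. Qed.

Section Completeness.
Context d (T : measurableType d) (R : realType).
Variables (mu : {measure set T -> \bar R}) (p : \bar R) (p1 : (1 <= p)%E).
Hypothesis muT : (mu setT < +oo)%E.
Local Notation L := (LspaceType mu p1).

Lemma Lspace_seriesE (x : L^nat) n :
  ((series x n : L) : T -> R) = (fun t => series (fun k => x k t) n) %[ae mu].
Proof.
elim: n => [|n IH].
  rewrite /series /= big_geq//; apply: filterS (Lspace0E mu p1) => t /(_ I) -> _ /=.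
  by rewrite big_geq.
rewrite /series /= big_nat_recr//=.
have := LspaceDE (\sum_(0 <= i < n) x i) (x n).
apply: filterS2 IH => t /(_ I); rewrite /series /= => h1 /(_ I) /= -> _.
by rewrite h1 big_nat_recr.
Qed.

(** As the measure is finite, the norms in [L^1] are summable too; hence the
    sum of the [|x n|] is integrable, and finite almost everywhere. *)
Lemma ae_series_cvg (x : L^nat) : cvgn [normed series x] ->
  exists2 f : T -> R, measurable_fun setT f &
    {ae mu, forall t, series (fun n => x n t) @ \oo --> f t}.
Proof.
move=> cx; have mx n : measurable_fun setT (x n : T -> R).
  exact: Lspace_measurable.
pose g n t : \bar R := `|x n t|%:E.
have mg n : measurable_fun setT (g n).
  by apply/measurable_EFinP; exact: measurableT_comp.
pose G t : \bar R := (\sum_(n <oo) g n t)%E.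
have g0 n t : (0 <= g n t)%E by rewrite lee_fin.
have mG : measurable_fun setT G.
  by apply: ge0_emeasurable_sum => // n t _ _; exact: g0.
have [C C0 CP] := Lspace_incl_bounded muT (lexx 1%E) p1 p1.
have intg n : (\int[mu]_t g n t <= (C * `|x n|)%:E)%E.
  have := CP (x n); rewrite -lee_fin LclassN; last exact: Lfun_incl.
  by rewrite Lnorm1.
have intG : (\int[mu]_t G t < +oo)%E.
  rewrite integral_nneseries//.
  apply: (@le_lt_trans _ _ (C * limn [normed series x])%:E); last exact: ltry.
  apply: lime_le.
    by apply: is_cvg_nneseries => n _ _; exact: integral_ge0.
  apply: nearW => n.
  apply: (@le_trans _ _ (\sum_(0 <= k < n) (C * `|x k|)%:E)%E).
    by apply: lee_sum => k _; exact: intg.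
  rewrite sumEFin lee_fin -mulr_sumr ler_wpM2l//.
  apply: (nondecreasing_cvgn_le _ cx n).
  exact: nondecreasing_normed_series.
have finG : {ae mu, forall t, G t \is a fin_num}.
  have : mu.-integrable setT G.
    apply/integrableP; split => //; under eq_integral => t _.
      rewrite gee0_abs; last by apply: nneseries_ge0.
      over.
    exact: intG.
  by move=> /(integrable_ae measurableT); apply: filterS => t /(_ I).
have cG t : G t \is a fin_num -> cvgn (series (fun n => x n t)).
  move=> Gt; apply: normed_cvg; apply: nondecreasing_is_cvgn.
    exact: nondecreasing_normed_series.
  exists (fine (G t)) => _ [n _ <-]; rewrite -lee_fin fineK// /normed_series_of /=.
  rewrite /series /= -sumEFin.
  by apply: nneseries_lim_ge => k _ _; exact: g0.
pose D := [set t | G t \is a fin_num].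
have mD : measurable D.
  by rewrite -[D]setTI; apply: emeasurable_fin_num.
(* Cutting off the partial sums outside [D] makes them converge everywhere,
   whence the measurability of the limit. *)
pose s n t := \1_D t * series (fun k => x k t) n.
exists (fun t => \1_D t * limn (series (fun n => x n t))).
  apply: (measurable_fun_cvg (h := s)) => [n|t _].
    apply: measurable_funM; first exact: measurable_indic.
    rewrite /series /=; apply: measurable_sum => k; exact: mx.
  have [Dt|Dt] := pselect (D t).
    by apply: cvgMr; exact: cG.
  rewrite /s indicE memNset//= mul0r; under eq_cvg do rewrite mul0r.
  exact: cvg_cst.
apply: filterS finG => t Gt; rewrite indicE mem_set// mul1r.
exact: cG.
Qed.

(** The pointwise sum [f] of an absolutely convergent series is its sum in
    [L^p]: by Fatou, the norm of [f] minus a partial sum is at most the tail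
    of the series of the norms. The same argument covers all [p]. *)
Lemma Lspace_complete : complete_space L.
Proof.
apply: complete_of_series => x cx.
have [f mf xf] := ae_series_cvg cx.
pose tail N := limn [normed series x] - [normed series x] N.
have tail0 N : 0 <= tail N.
  rewrite subr_ge0; apply: (nondecreasing_cvgn_le _ cx N).
  exact: nondecreasing_normed_series.
have tailN N n : `|series x (N + n)%N - series x N| <= tail N.
  rewrite sub_series_geq ?leq_addr// (le_trans (ler_norm_sum _ _ _))//.
  rewrite lerBrDr; apply: (@le_trans _ _ ([normed series x] (N + n)%N)).
    by rewrite -lerBrDr sub_series_geq ?leq_addr.
  apply: (nondecreasing_cvgn_le _ cx).
  exact: nondecreasing_normed_series.
have fN N : ('N[mu]_p[EFin \o (fun t => (f t - (series x N : L) t)%R)]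
    <= (tail N)%:E)%E.
  pose u n := (series x (N + n)%N - series x N : L).
  apply: (Lnorm_fatou (u := fun n => u n : T -> R)) => //.
  - by move=> n; exact: Lspace_measurable.
  - by apply: measurable_funB => //; exact: Lspace_measurable.
  - have uE : {ae mu, forall t, forall n,
        (u n : T -> R) t = series (fun k => x k t) (N + n)%N - (series x N : L) t}.
      apply: ae_foralln => n.
      have h1 := LspaceDE (series x (N + n)%N) (- series x N).
      have h2 := LspaceNE (series x N).
      apply: filterS3 h1 h2 (Lspace_seriesE x (N + n)%N).
      by move=> t /(_ I) h1 /(_ I) h2 /(_ I) h3; rewrite /u h1 /= h2 h3.
    apply: filterS2 xf uE => t xt ut.
    under eq_cvg do rewrite ut.
    apply: cvgB; last exact: cvg_cst.
    rewrite (_ : (fun n => _) = [sequence series (fun k => x k t) (n + N)%N]_n).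
      by rewrite cvg_shiftn.
    by apply/funext => n; rewrite /= addnC.
  - by move=> n; rewrite -LspaceN lee_fin; exact: tailN.
have fp : f \in Lfun mu p.
  apply/andP; split; rewrite inE//= /finite_norm.
  apply: le_lt_trans (ltry (tail 0)); apply: le_trans (fN 0%N).
  apply: le_Lnorm => //.
    by apply: measurable_funB => //; exact: Lspace_measurable.
  apply: filterS (Lspace_seriesE x 0%N) => t /(_ I) ->.
  by rewrite /series /= big_geq// subr0.
have tail_lim : tail N @[N --> \oo] --> 0.
  rewrite -(subrr (limn [normed series x])); apply: cvgB => //; exact: cvg_cst.
apply/cvg_ex; exists (Lclass mu p1 f); apply/cvgrPdist_le => e e0.
move/cvgrPdist_le : tail_lim => /(_ e e0); apply: filterS => N.
rewrite sub0r normrN ger0_norm// => te; apply: le_trans te.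
rewrite -lee_fin LspaceN; apply: le_trans (fN N); apply: le_Lnorm => //.
- exact: Lspace_measurable.
- by apply: measurable_funB => //; exact: Lspace_measurable.
have h1 := LspaceDE (Lclass mu p1 f) (- series x N).
have h2 := LspaceNE (series x N).
apply: filterS3 h1 h2 (LclassE p1 fp).
by move=> t /(_ I) -> /(_ I) /= -> /(_ I) ->.
Qed.

End Completeness.

(** * Bounded continuous functions *)

Section BoundedContinuous.
Context (T : ptopologicalType) (R : realType).
Local Notation C := (bcfun T R).
Implicit Types u v : C.

Lemma bcfun_norm_ge v t : `|v t| <= `|v|.
Proof. exact: sup_norm_ub. Qed.

Lemma bcfun_seriesE (x : C^nat) n t :
  (series x n : C) t = series (fun k => x k t) n.
Proof.
rewrite /series /=; elim: n => [|n IH]; first by rewrite !big_geq.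
by rewrite !big_nat_recr//= -IH.
Qed.

(** The pointwise sum is a uniform limit of continuous functions. *)
Lemma bcfun_complete : complete_space C.
Proof.
apply: complete_of_series => x cx.
have cR : complete_space R^o by move=> F FF; exact: R_complete.
have xt t n : `|x n t : R^o| <= `|x n| by exact: bcfun_norm_ge.
pose f t : R := limn (series (fun k => x k t : R^o)).
pose tail N := limn [normed series x] - [normed series x] N.
have tailf N t : `|f t - (series x N : C) t| <= tail N.
  by rewrite bcfun_seriesE; exact: (dominated_series_tail N cR (xt t) cx).
have tail_lim : tail N @[N --> \oo] --> 0.
  rewrite -(subrr (limn [normed series x])); apply: cvgB => //; exact: cvg_cst.
have cf : continuous f.
  move=> t; apply/cvgrPdist_le => e e0.
  have e30 : 0 < e / 3 by rewrite divr_gt0.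
  move/cvgrPdist_le : tail_lim => /(_ _ e30) [N _ /(_ N (leqnn N))] /=.
  rewrite sub0r normrN => tN; have {}tN := le_trans (ler_norm _) tN.
  have [/(_ t)/cvgrPdist_le/(_ _ e30) cN _] := bcfunP (series x N).
  apply: filterS cN => s ts.
  have h1 := tailf N t; have h2 := tailf N s.
  rewrite (le_trans (ler_distD ((series x N : C) t) _ _))//.
  have := ler_distD ((series x N : C) s) ((series x N : C) t) (f s).
  move: h1 h2; rewrite [`|f s - _|]distrC; lra.
have bf : bounded_continuous f.
  split => //; exists (tail 0) => t; have := tailf 0%N t.
  by rewrite bcfun_seriesE /series /= big_geq// subr0.
apply/cvg_ex; exists (BCfun bf : C); apply/cvgrPdist_le => e e0.
move/cvgrPdist_le : tail_lim => /(_ e e0); apply: filterS => N.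
rewrite sub0r normrN => tN; apply: le_trans (le_trans (ler_norm _) tN).
by apply: sup_norm_le => t; exact: tailf.
Qed.

Lemma bounded_continuousM (h f : T -> R) : bounded_continuous h ->
  bounded_continuous f -> bounded_continuous (fun x => h x * f x).
Proof.
move=> [ch [M hM]] [cf [N fN]]; split.
  by move=> x; apply: cvgM; [exact: ch|exact: cf].
by exists (M * N) => x; rewrite normrM ler_pM.
Qed.

Definition bcmul (h : T -> R) (bh : bounded_continuous h) (v : C) : C :=
  BCfun (bounded_continuousM bh (bcfunP v)).

Lemma bcmul_linear h (bh : bounded_continuous h) : linear (bcmul bh).
Proof.
by move=> a u v; apply: bcfun_ext => t /=; rewrite mulrDr mulrCA.
Qed.

Lemma bcmul_bounded h (bh : bounded_continuous h) :
  exists M : R, forall v, `|bcmul bh v| <= M * `|v|.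
Proof.
have [_ [M hM]] := bh; exists M => v; apply: sup_norm_le => t.
by rewrite normrM ler_pM// bcfun_norm_ge.
Qed.

End BoundedContinuous.

(** * The two target spaces *)

Section Borel.
Context d (R : realType) (T : metricMeasurableType d R).
Hypothesis borel : forall U : set T, open U -> measurable U.

Lemma continuous_measurable (f : T -> R) :
  continuous f -> measurable_fun setT f.
Proof.
move=> cf; apply: (measurability _ (RGenOInfty.measurableE R)).
move=> _ [_ [x ->] <-]; rewrite setTI; apply: borel.
by apply: open_comp => //; rewrite set_itvoy; exact: open_gt.
Qed.

End Borel.

Section Target.
Context d (R : realType) (T : metricMeasurableType d R).
Variables (mu : {measure set T -> \bar R}) (p : \bar R) (p1 : (1 <= p)%E).
Hypothesis borel : forall U : set T, open U -> measurable U.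
Hypothesis muT : (mu setT < +oo)%E.
Local Notation Lp := (LspaceType mu p1).

Lemma bcfun_measurable (v : bcfun T R) : measurable_fun setT (v : T -> R).
Proof. by apply: continuous_measurable => //; case: (bcfunP v). Qed.

Lemma bcfun_Lfun (v : bcfun T R) : (v : T -> R) \in Lfun mu p.
Proof.
apply: (bounded_Lfun muT (c := `|v|)) => //; first exact: bcfun_measurable.
by apply: aeW => t; exact: bcfun_norm_ge.
Qed.

Lemma bcfun_embed_bounded : exists M : R, forall v : bcfun T R,
  `|Lclass mu p1 v| <= M * `|v|.
Proof.
have c1 : (cst 1 : T -> R) \in Lfun mu p.
  by apply: (bounded_Lfun muT (c := 1)) => //; apply: aeW => x /=; rewrite normr1.
exists `|Lclass mu p1 (cst 1)| => v.
have [] := @Lfun_dominated _ _ _ mu p p1 v (Lclass mu p1 (cst 1)) `|v|.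
- exact: bcfun_measurable.
- apply: filterS (LclassE p1 c1) => t /(_ I) ->.
  by rewrite /= normr1 mulr1 bcfun_norm_ge.
- by move=> _; rewrite normr_id mulrC.
Qed.

Lemma target_coef_bounded (X : target p) h : target_coef mu X h ->
  measurable_fun setT h /\ exists c : R, {ae mu, forall x, `|h x| <= c}.
Proof.
case: X => [q q1 pq|] /= hX.
  by split; [exact: Lfun_measurable hX|exact: Lfuny_bounded].
split; first by apply: continuous_measurable => //; case: hX.
by have [_ [M hM]] := hX; exists M; apply: aeW.
Qed.

Lemma target_complete (X : target p) : complete_space (target_space mu X).
Proof.
by case: X => [q q1 pq|]; [exact: Lspace_complete|exact: bcfun_complete].
Qed.

Lemma target_embed_linear (X : target p) :
  linear (@target_embed d R T mu p p1 X).
Proof.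
case: X => [q q1 pq|]; first exact: Lspace_incl_linear.
by move=> a u v; rewrite -(Lclass_linear p1 a (bcfun_Lfun u) (bcfun_Lfun v)).
Qed.

Lemma target_embed_bounded (X : target p) : exists M : R,
  forall v : target_space mu X, `|target_embed p1 v| <= M * `|v|.
Proof.
case: X => [q q1 pq|]; last exact: bcfun_embed_bounded.
by have [M _ hM] := Lspace_incl_bounded muT p1 q1 pq; exists M.
Qed.

(** Multiplication by [h] acts on [X] as well, because [h] is essentially bounded
    in the first case and bounded and continuous in the second. This is the lift
    [NX] of the abstract result, up to the sign. *)
Lemma target_mul (X : target p) h : target_coef mu X h ->
  exists H : {linear target_space mu X -> target_space mu X}, continuous H /\
    forall v, target_embed p1 (H v) = mul_operator h (target_embed p1 v).
Proof.
move=> hX; have [mh [c hc]] := target_coef_bounded hX.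
case: X hX => [q q1 pq|] /= hX.
  exists (linear_of (mul_operator_linear (p1 := q1) mh hc)); split.
    apply: (bounded_op_continuous (k := `|c|)) => v.
    by case: (mul_operator_dominated mh hc v).
  move=> v; apply: Lclass_ae.
  apply: filterS2 (mul_operatorE mh hc v) (LclassE p1 (Lfun_incl muT p1 pq v)).
  by move=> x /(_ I) h1 /(_ I) h2 _; rewrite [LHS]h1 h2.
exists (linear_of (bcmul_linear hX)); split.
  have [M hM] := bcmul_bounded hX.
  by apply: (bounded_op_continuous (k := M)) => v; exact: hM.
move=> v; apply: Lclass_ae.
by apply: filterS (LclassE p1 (bcfun_Lfun v)) => x /(_ I) h1 _; rewrite h1.
Qed.

End Target.

(** * The nonlocal problem *)

Theorem theorem4p5 (d : measure_display) (R : realType)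
    (T : metricMeasurableType d R) (mu : {measure set T -> \bar R})
    (p : \bar R) (p1 : (1 <= p)%E) (X : target p)
    (J : T -> T -> R) (h : T -> R) (alpha : R)
    (K : {linear LspaceType mu p1 -> target_space mu X}) :
  metric_measure_space mu ->
  (mu [set: T] < +oo)%E ->
  (forall x y, 0 <= J x y) ->
  kernel_operator J K ->
  continuous K ->
  compact_operator K ->
  target_coef mu X h ->
  0 < alpha ->
  (forall x, alpha <= h x) ->
  let A := nonlocal_operator K h in
  let S := exp_group A in
  [/\ forall (u0 : LspaceType mu p1) (u : R -> LspaceType mu p1),
        solves A u0 u <-> (forall t, 0 <= t -> u t = S t u0),
      exists (S1 : R -> {linear LspaceType mu p1 -> LspaceType mu p1})
             (S2 : R -> {linear LspaceType mu p1 -> target_space mu X}),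
        [/\ forall t u0, 0 <= t ->
              S t u0 = S1 t u0 + target_embed p1 (S2 t u0),
            forall t, 0 < t -> continuous (S1 t),
            exists M omega : R, 0 < omega /\
              (forall t, 0 < t ->
                (op_norm (S1 t) <= (M * expR (- (omega * t)))%:E)%E) &
            forall t, 0 < t -> continuous (S2 t) /\ compact_operator (S2 t)]
    & asymptotically_smooth S].
Proof.
move=> [borel _ _ _ _] muT _ _ cK kK hX a0 ah A S.
have [mh [c hc]] := target_coef_bounded borel hX.
have [H [cH HE]] := target_mul p1 borel muT hX.
have [M hM] := target_embed_bounded p1 borel muT X.
pose iota := linear_of (target_embed_linear p1 borel muT (X := X)).
pose Hp := linear_of (mul_operator_linear (p1 := p1) mh hc).
have lN (E : lmodType R) (f : {linear E -> E}) : linear (fun u => - f u).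
  by move=> a u v; rewrite linearP opprD scalerN.
have cNeg (E : normedModType R) (f : {linear E -> E}) : continuous f ->
    continuous (linear_of (@lN E f)).
  by move=> cf u; apply: cvgN; exact: cf.
have cHp : continuous Hp.
  apply: (bounded_op_continuous (k := `|c|)) => u.
  by case: (mul_operator_dominated mh hc u).
have ci : continuous iota.
  by apply: (bounded_op_continuous (k := M)) => u; exact: hM.
have iN v : iota (linear_of (lN _ H) v) = linear_of (lN _ Hp) (iota v).
  by rewrite [LHS](linearN iota); congr (- _); exact: HE.
have dissN r u : 0 < r ->
    (1 + r * alpha) * `|u| <= `|u - r *: linear_of (lN _ Hp) u|.
  move=> r0; rewrite /= scalerN opprK.
  by apply: (mul_operator_expansive mh hc); rewrite ?ltW.
have AE u : A u = iota (K u) + linear_of (lN _ Hp) u by [].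
exact: (compact_perturbation (Lspace_complete muT) (target_complete muT (X := X))
  (cNeg _ Hp cHp) (cNeg _ H cH) cK ci iN kK a0 dissN AE).
Qed.
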